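(* In the setting described in the context, assume that (i) there exists a symmetric positive-definite matrix $C\in\mathbb{R}^{N\times N}$ such that, almost surely, $$\mathbb{E}\left[\exp\left(\alpha^\top C^{-1/2}(E-\mathbb{E}[E\mid Y])\right)\,\middle|\,Y\right]\le \exp\left(\|\alpha\|_2^2/2\right)\quad\text{for all }\alpha\in\mathbb{R}^N;$$ (ii) there is $\mu\in\mathbb{R}^N$ such that $|(\mathbb{E}[E\mid Y])_i|\le\mu_i$ almost surely for $1\le i\le N$; (iii) $C_{YY}^{-1/2}Y$ is a $\rho$-sub-Gaussian random vector. Moreover, assume that the linear minimum mean squared error estimator and the minimum mean squared error estimator coincide (equivalently, $\mathbb{E}[E\mid Y]=0$ almost surely). Let $\varepsilon>0$ and $\delta\in(0,1)$. If the number of samples $n$ is an integer with $$n\ge\left(\sqrt{\frac{\operatorname{tr}(C)M+2\sqrt{M\operatorname{tr}(C^2)\ln(3/\delta)}+2\|C\|_2\ln(3/\delta)}{\operatorname{tr}(C_{EE})\,\varepsilon}}+c\rho^2\left(\sqrt M+\sqrt{\ln(3/\delta)}\right)\right)^2,$$ then, with probability at least $1-\delta$, $$\mathbb{E}_{X,Y}\left[\|\hat\Theta^\top Y-X\|_2^2\right]\le\operatorname{tr}(C_{EE})(1+\varepsilon).$$ Here $c>0$ is the absolute constant described in the context.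
   Context: Setting. $X$ (values in $\mathbb{R}^N$) and $Z$ (values in $\mathbb{R}^M$) are independent, square integrable random vectors with mean zero and invertible covariance matrices $C_{XX}$, $C_{ZZ}$, whose laws have continuous densities with respect to Lebesgue measure. $A\in\mathbb{R}^{M\times N}$ is a fixed matrix, $Y:=AX+Z$, and $C_{YY}$ is the covariance matrix of $Y$. The matrix $\Theta_*\in\mathbb{R}^{M\times N}$ is defined by $\Theta_*^\top:=(A^\top C_{ZZ}^{-1}A+C_{XX}^{-1})^{-1}A^\top C_{ZZ}^{-1}$. The linear minimum mean squared error estimator is $f_{\mathrm{LMMSE}}(Y)=\Theta_*^\top Y$; its mean squared error is $\operatorname{tr}(C_{EE})$ with $C_{EE}:=C_{XX}-C_{XX}A^\top(AC_{XX}A^\top+C_{ZZ})^{-1}AC_{XX}$. The minimum mean squared error estimator is $f_{\mathrm{MMSE}}(Y)=\mathbb{E}[X\mid Y]$. The estimation error is $E:=X-\Theta_*^\top Y$. $\{(X_i,Y_i)\}_{i=1}^n$ are $n$ independent samples of $(X,Y)$. The matrices $\boldsymbol{X}\in\mathbb{R}^{n\times N}$ and $\boldsymbol{Y}\in\mathbb{R}^{n\times M}$ have rows $X_i^\top$ and $Y_i^\top$. The least squares estimator is $\hat f(y)=\hat\Theta^\top y$, where $\hat\Theta$ minimizes $\frac1n\|\boldsymbol{Y}\Theta-\boldsymbol{X}\|_F^2$ over $\Theta\in\mathbb{R}^{M\times N}$; if $\boldsymbol{Y}$ is injective it is unique and $\hat\Theta=(\boldsymbol{Y}^\top\boldsymbol{Y})^{-1}\boldsymbol{Y}^\top\boldsymbol{X}$.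 $\mathbb{E}_{X,Y}$ denotes expectation over a fresh pair $(X,Y)$ independent of the samples, with the samples held fixed; ''with probability'' refers to the samples. $\|\cdot\|_2$ is the Euclidean norm for vectors and the spectral norm for matrices. A real random variable $V$ is sub-Gaussian with parameter $\sigma\ge0$ if $\mathbb{E}[e^{\lambda(V-\mathbb{E}V)}]\le e^{\sigma^2\lambda^2/2}$ for all $\lambda\in\mathbb{R}$. A random vector $V$ is $\sigma$-sub-Gaussian if $a^\top V$ is sub-Gaussian with parameter $\sigma$ for every unit vector $a$. The constant $c>0$ is an absolute constant with the following property (such a constant exists): for all $n,M$, every $\rho$, every random $n\times M$ matrix $W$ whose rows are independent $\rho$-sub-Gaussian isotropic (identity covariance) random vectors in $\mathbb{R}^M$, and every $t\ge0$, with probability at least $1-2e^{-t}$, $\sqrt n-c\rho^2(\sqrt M+\sqrt t)\le\sigma_{\min}(W)\le\sigma_{\max}(W)\le\sqrt n+c\rho^2(\sqrt M+\sqrt t)$, where $\sigma_{\min},\sigma_{\max}$ are the minimal and maximal singular values. *)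

(* Defs.v *)
From HB Require Import structures.
From mathcomp Require Import all_boot all_order all_algebra.
From mathcomp Require Import all_classical all_reals all_analysis.

Set Implicit Arguments.
Unset Strict Implicit.
Unset Printing Implicit Defensive.

Import Order.TTheory GRing.Theory Num.Theory.
Import numFieldNormedType.Exports.

Local Open Scope classical_set_scope.
Local Open Scope ring_scope.

(* Vectors of R^k are column vectors. The library norm on matrices is the
   sup norm, whence the separate Euclidean, Frobenius and spectral norms. *)

Definition norm2 (R : realType) (k : nat) (v : 'cV[R]_k) : R :=
  Num.sqrt (\sum_(i < k) v i 0 ^+ 2).

Definition normF (R : realType) (m n : nat) (A : 'M[R]_(m, n)) : R :=
  Num.sqrt (\sum_(i < m) \sum_(j < n) A i j ^+ 2).

Definition spectral_norm (R : realType) (m n : nat) (A : 'M[R]_(m, n)) : R :=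
  sup [set norm2 (A *m v) | v in [set v : 'cV[R]_n | norm2 v = 1]].

Definition psdmx (R : realType) (k : nat) (S : 'M[R]_k) : Prop :=
  S^T = S /\ forall v : 'cV[R]_k, 0 <= (v^T *m S *m v) 0 0.

Definition posdefmx (R : realType) (k : nat) (S : 'M[R]_k) : Prop :=
  S^T = S /\ forall v : 'cV[R]_k, v != 0 -> 0 < (v^T *m S *m v) 0 0.

(* The principal square root: a positive semidefinite S has exactly one
   positive semidefinite square root. The default value 0 is only taken when S
   is not positive semidefinite. *)
Definition sqrtmx (R : realType) (k : nat) (S : 'M[R]_k) : 'M[R]_k :=
  xget 0 [set Q : 'M[R]_k | psdmx Q /\ Q *m Q = S].

Definition invsqrtmx (R : realType) (k : nat) (S : 'M[R]_k) : 'M[R]_k :=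
  invmx (sqrtmx S).

(* An n x k matrix has k singular values, also when n < k: 0 is then one of
   them. *)
Definition singular_value (R : realType) (n k : nat) (W : 'M[R]_(n, k)) (s : R)
    : Prop :=
  0 <= s /\ eigenvalue (W^T *m W) (s ^+ 2).

Definition sigma_min (R : realType) (n k : nat) (W : 'M[R]_(n, k)) : R :=
  inf [set s | singular_value W s].

Definition sigma_max (R : realType) (n k : nat) (W : 'M[R]_(n, k)) : R :=
  sup [set s | singular_value W s].

Definition sigma_of (R : realType) (T : Type) (k : nat) (V : T -> 'cV[R]_k)
    : set (set T) :=
  g_sigma_preimage (fun (i : 'I_k) (w : T) => V w i 0).

(* The Borel sigma-algebra of R^k, as the product of k copies of that of R. *)
Definition borel_cV (R : realType) (k : nat) : set (set 'cV[R]_k) :=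
  sigma_of (fun v : 'cV[R]_k => v).

Definition random_vector d (T : measurableType d) (R : realType) (k : nat)
    (V : T -> 'cV[R]_k) : Prop :=
  forall i, measurable_fun setT (fun w => V w i 0).

Definition mean_vec d (T : measurableType d) (R : realType)
    (P : probability T R) (k : nat) (V : T -> 'cV[R]_k) : 'cV[R]_k :=
  \col_i fine ('E_P[(fun w => V w i 0)%R])%E.

Definition covmx d (T : measurableType d) (R : realType)
    (P : probability T R) (k : nat) (V : T -> 'cV[R]_k) : 'M[R]_k :=
  \matrix_(i, j) fine (covariance P (fun w => V w i 0) (fun w => V w j 0)).

Definition square_integrable d (T : measurableType d) (R : realType)
    (P : probability T R) (k : nat) (V : T -> 'cV[R]_k) : Prop :=
  forall i, (fun w => V w i 0) \in Lfun P 2%:E.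

Definition independent2 d (T : measurableType d) (R : realType)
    (P : probability T R) (k l : nat)
    (U : T -> 'cV[R]_k) (V : T -> 'cV[R]_l) : Prop :=
  forall A B, sigma_of U A -> sigma_of V B -> P (A `&` B) = (P A * P B)%E.

(* Mutual independence of a finite family; since setT belongs to every
   sigma-algebra, the product rule for full families contains the one for
   subfamilies. *)
Definition independent_family d (T : measurableType d) (R : realType)
    (P : probability T R) (n k : nat) (V : 'I_n -> T -> 'cV[R]_k) : Prop :=
  forall A : 'I_n -> set T, (forall i, sigma_of (V i) (A i)) ->
    P (\bigcap_i A i) = (\prod_(i < n) fine (P (A i)))%:E.

Definition same_law d (T : measurableType d) d' (T' : measurableType d')
    (R : realType) (P : probability T R) (P' : probability T' R) (k : nat)
    (U : T -> 'cV[R]_k) (V : T' -> 'cV[R]_k) : Prop :=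
  forall B, borel_cV B -> P (U @^-1` B) = P' (V @^-1` B).

(* The Lebesgue integral over R^k of a nonnegative Borel function, as an
   iterated integral (Tonelli). *)
Fixpoint integral_cV (R : realType) (k : nat)
    : ('cV[R]_k -> \bar R) -> \bar R :=
  if k is k'.+1 then fun f : 'cV[R]_(1 + k') -> \bar R =>
    (\int[lebesgue_measure]_x
       integral_cV (fun v : 'cV[R]_k' => f (col_mx (x : R)%:M v)))%E
  else fun f => f 0.

Definition has_continuous_density d (T : measurableType d) (R : realType)
    (P : probability T R) (k : nat) (V : T -> 'cV[R]_k) : Prop :=
  exists f : 'cV[R]_k -> R,
    [/\ continuous f, forall v, 0 <= f v &
        forall B, borel_cV B ->
          P (V @^-1` B) = integral_cV (fun v => (f v * \1_B v)%:E)].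

(* V is a version of the conditional expectation of the integrable random
   variable U given the sub-sigma-algebra G. *)
Definition is_cond_exp d (T : measurableType d) (R : realType)
    (P : probability T R) (G : set (set T)) (U V : T -> R) : Prop :=
  [/\ P.-integrable setT (EFin \o U),
      P.-integrable setT (EFin \o V),
      forall B : set R, measurable B -> G (V @^-1` B) &
      forall A, G A ->
        (\int[P]_(w in A) (V w)%:E = \int[P]_(w in A) (U w)%:E)%E].

Definition is_cond_exp_vec d (T : measurableType d) (R : realType)
    (P : probability T R) (G : set (set T)) (k : nat) (U V : T -> 'cV[R]_k)
    : Prop :=
  forall i, is_cond_exp P G (fun w => U w i 0) (fun w => V w i 0).

Definition sub_gaussian d (T : measurableType d) (R : realType)
    (P : probability T R) (V : T -> R) (s : R) : Prop :=
  [/\ 0 <= s,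
      P.-integrable setT (EFin \o V) &
      forall l : R,
        ('E_P[(fun w => expR (l * (V w - fine 'E_P[V]%E)))%R]
           <= (expR (s ^+ 2 * l ^+ 2 / 2))%:E)%E].

Definition sub_gaussian_vec d (T : measurableType d) (R : realType)
    (P : probability T R) (k : nat) (V : T -> 'cV[R]_k) (s : R) : Prop :=
  forall a : 'cV[R]_k, norm2 a = 1 ->
    sub_gaussian P (fun w => (a^T *m V w) 0 0) s.

(* The event A contains a measurable event of probability at least p; for
   measurable A this is p <= P A. *)
Definition with_prob_ge d (T : measurableType d) (R : realType)
    (P : probability T R) (p : R) (A : set T) : Prop :=
  exists2 B, measurable B /\ B `<=` A & (p%:E <= P B)%E.

(* Isotropic means centred with identity covariance. Without centring no c
   would qualify: the constraints on the rows would not bound their means. *)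
Definition singular_value_constant (R : realType) (c : R) : Prop :=
  forall (d : measure_display) (T : measurableType d) (P : probability T R)
    (n k : nat) (rho : R) (W : T -> 'M[R]_(n, k)) (t : R),
  (0 < k)%N ->
  independent_family P (fun i w => (row i (W w))^T) ->
  (forall i : 'I_n,
    [/\ sub_gaussian_vec P (fun w => (row i (W w))^T) rho,
        mean_vec P (fun w => (row i (W w))^T) = 0 &
        covmx P (fun w => (row i (W w))^T) = 1%:M]) ->
  0 <= t ->
  with_prob_ge P (1 - 2 * expR (- t))
    [set w |
      [/\ Num.sqrt n%:R - c * rho ^+ 2 * (Num.sqrt k%:R + Num.sqrt t)
            <= sigma_min (W w),
          sigma_min (W w) <= sigma_max (W w) &
          sigma_max (W w)
            <= Num.sqrt n%:R + c * rho ^+ 2 * (Num.sqrt k%:R + Num.sqrt t)]].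

Definition lmmse_mx (R : realType) (N M : nat) (A : 'M[R]_(M, N))
    (CXX : 'M[R]_N) (CZZ : 'M[R]_M) : 'M[R]_(M, N) :=
  (invmx (A^T *m invmx CZZ *m A + invmx CXX) *m A^T *m invmx CZZ)^T.

Definition error_covmx (R : realType) (N M : nat) (A : 'M[R]_(M, N))
    (CXX : 'M[R]_N) (CZZ : 'M[R]_M) : 'M[R]_N :=
  CXX - CXX *m A^T *m invmx (A *m CXX *m A^T + CZZ) *m A *m CXX.

Definition mse d (T : measurableType d) (R : realType) (P : probability T R)
    (N M : nat) (X : T -> 'cV[R]_N) (Y : T -> 'cV[R]_M) (Theta : 'M[R]_(M, N))
    : \bar R :=
  ('E_P[(fun w => norm2 (Theta^T *m Y w - X w) ^+ 2)%R])%E.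

Definition sample_mx (R : realType) (T : Type) (n k : nat)
    (V : 'I_n -> T -> 'cV[R]_k) (w : T) : 'M[R]_(n, k) :=
  \matrix_(i, j) V i w j 0.

Definition least_squares (R : realType) (n N M : nat) (Y : 'M[R]_(n, M))
    (X : 'M[R]_(n, N)) (Theta : 'M[R]_(M, N)) : Prop :=
  forall Theta' : 'M[R]_(M, N),
    n%:R^-1 * normF (Y *m Theta - X) ^+ 2
      <= n%:R^-1 * normF (Y *m Theta' - X) ^+ 2.

(* Main.v *)
(* Write Theta0 for the LMMSE matrix, E_i = X_i - Theta0^T Y_i, S for the square
   root of C_YY, W for the matrix with rows S^-1 Y_i, and B = (W^T W)^-1 W^T.  As
   E is uncorrelated with Y, the mean squared error of Theta is
   tr C_EE + |S (Theta - Theta0)|_F^2, and the normal equations give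
   S (Theta_hat - Theta0) = B Err, where Err has rows E_i.  The event
   s <= sigma_min(W), which depends on the Y_i only, forces B B^T <= s^-2.  Given
   the Y_i, the rows of Err are independent and C-sub-Gaussian.  Let U diagonalize
   C.  Writing exp (eta z^2), for each entry z of B Err U, as a Gaussian average of
   exp (sqrt (2 eta) g z) bounds E exp (eta |B Err|_F^2) on that event by the
   product, over the entries, of (1 - 2 eta lambda / s^2)^-1/2, lambda being the
   eigenvalue of C for the column of the entry.  Chernoff's bound then has exactly
   the deviation of the theorem. *)

(* The obstacle is that the matrix B in front of the errors depends on the observations, while (i)
   bounds a conditional expectation for deterministic exponents. Instead of conditional laws, the
   proof keeps every conditional bound in integrated form: over each event that Y lies in D, the
   integral of a nonnegative weight is at most the probability of the event. This form passes to the
   whole sample by Fubini, and to exponents that are measurable functions of the Y_i by rounding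
   them to countably many values. Coincidence of the two estimators makes E[E | Y] vanish, so that
   (i) speaks of E itself. With t = ln (3 / delta), the singular value bound costs 2 exp (-t) and
   the Chernoff bound exp (-t), in total delta. Let K be the numerator under the outer root in the
   condition on n, and s that root. Then s^-2 K = eps tr C_EE is exactly the excess error allowed,
   and the other term of the condition absorbs the fluctuation of sigma_min. *)
Require Import Defs.
From HB Require Import structures.
From mathcomp Require Import all_boot all_order all_algebra.
From mathcomp Require Import all_classical all_reals all_analysis.
From mathcomp Require Import measurable_realfun.
From mathcomp Require Import complex spectral ring lra.

Set Implicit Arguments.
Unset Strict Implicit.
Unset Printing Implicit Defensive.

Import Order.TTheory GRing.Theory Num.Theory.
Import numFieldNormedType.Exports.

Local Open Scope classical_set_scope.
Local Open Scope ring_scope.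

(** * Real spectral theorem *)

Section Spectral.
Variable R : rcfType.

Lemma sqmx_ge0 (n : nat) (v : 'cV[R]_n) : 0 <= (v^T *m v) 0 0.
Proof.
rewrite mxE; apply: sumr_ge0 => i _; rewrite mxE -expr2; exact: sqr_ge0.
Qed.

Lemma sqmx_eq0 (n : nat) (v : 'cV[R]_n) : ((v^T *m v) 0 0 == 0) = (v == 0).
Proof.
apply/idP/idP => [|/eqP ->]; last by rewrite mulmx0 mxE.
rewrite mxE psumr_eq0 => [/allP v0|i _]; last by rewrite mxE -expr2 sqr_ge0.
apply/eqP/matrixP => i j; rewrite ord1 mxE.
by have := v0 i (mem_index_enum _); rewrite /= mxE mulf_eq0 orbb => /eqP.
Qed.

Lemma sqmx_gt0 (n : nat) (v : 'cV[R]_n) : (0 < (v^T *m v) 0 0) = (v != 0).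
Proof. by rewrite lt_def sqmx_eq0 sqmx_ge0 andbT. Qed.

(** Over the algebraically closed field [R[i]] there is an eigenvalue a + ib with eigenvector x +
    iy. Symmetry forces b = 0, and then whichever of x and y is nonzero is a real eigenvector. *)
Lemma symmetric_eigenvector (n : nat) (S : 'M[R]_n.+1) : S^T = S ->
  exists (a : R) (v : 'cV[R]_n.+1), v != 0 /\ S *m v = a *: v.
Proof.
move=> symS.
pose SC : 'M[R[i]]_n.+1 := map_mx (real_complex R) S.
have [[a b] /eigenvalueP[z zE z0]] := eigenvalue_closed SC (ltn0Sn n).
pose x : 'rV[R]_n.+1 := map_mx (@complex.Re R) z.
pose y : 'rV[R]_n.+1 := map_mx (@complex.Im R) z.
have zi i : z 0 i = ((x 0 i) +i* (y 0 i))%C by rewrite !mxE; case: (z 0 i).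
have sumC (F G : 'I_n.+1 -> R) :
    \sum_i ((F i) +i* (G i))%C = ((\sum_i F i) +i* (\sum_i G i))%C.
  by elim/big_rec3: _ => // i p q r _ ->.
have xyE i : (x *m S) 0 i = a * x 0 i - b * y 0 i /\
             (y *m S) 0 i = a * y 0 i + b * x 0 i.
  have := congr1 (fun m : 'rV_n.+1 => m 0 i) zE.
  rewrite mxE (eq_bigr (fun j => ((x 0 j * S j i) +i* (y 0 j * S j i))%C)); last first.
    move=> j _; rewrite zi [SC _ _]mxE; apply/eqP; rewrite eq_complex /=.
    by rewrite !mulr0 subr0 add0r !eqxx.
  rewrite sumC mxE zi => -[e1 e2]; rewrite !mxE; split.
  - by rewrite e1 /= !mxE.
  - by rewrite e2 /= !mxE.
have xS : x *m S = a *: x - b *: y.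
  by apply/rowP => i; have [e _] := xyE i; rewrite e !mxE.
have yS : y *m S = a *: y + b *: x.
  by apply/rowP => i; have [_ e] := xyE i; rewrite e !mxE.
have symq : x *m S *m y^T = (y *m S *m x^T)^T.
  by rewrite !trmx_mul trmxK symS mulmxA.
have n0 : 0 < (x *m x^T) 0 0 + (y *m y^T) 0 0.
  have xx0 := sqmx_ge0 x^T; have yy0 := sqmx_ge0 y^T.
  rewrite trmxK in xx0; rewrite trmxK in yy0.
  rewrite lt_def addr_ge0 // andbT paddr_eq0 //.
  apply: contra z0 => /andP[x0 y0].
  move: (sqmx_eq0 x^T) (sqmx_eq0 y^T); rewrite !trmxK x0 y0 => /esym/eqP x0' /esym/eqP y0'.
  apply/eqP/rowP => i; rewrite zi.
  move/matrixP/(_ i 0): x0'; move/matrixP/(_ i 0): y0'; rewrite !mxE => -> ->.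
  by [].
(* Expanding x S y^T = (y S x^T)^T with the two real equations leaves b (|x|^2 + |y|^2) = 0. *)
have b0 : b = 0.
  move/matrixP/(_ 0 0): symq; rewrite xS yS mulmxBl mulmxDl -!scalemxAl.
  have -> : x *m y^T = (y *m x^T)^T by rewrite trmx_mul trmxK.
  rewrite !mxE => /eqP; rewrite -subr_eq0.
  move: n0; rewrite !mxE; set p := \sum_j _; set q := \sum_j _; set r := \sum_j _.
  move=> pq0.
  have -> : a * r - b * q - (a * r + b * p) = - (b * (p + q)) by ring.
  rewrite oppr_eq0 mulf_eq0 => /orP[/eqP //|]; by rewrite gt_eqF.
have [x0|x0] := eqVneq x 0.
  have y0 : y != 0.
    apply: contraTneq n0 => ->; by rewrite x0 !mul0mx mxE addr0 ltxx.
  exists a, y^T; split; first by rewrite trmx_eq0.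
  by rewrite -[S in LHS]symS -trmx_mul yS b0 scale0r addr0 linearZ.
exists a, x^T; split; first by rewrite trmx_eq0.
by rewrite -[S in LHS]symS -trmx_mul xS b0 scale0r subr0 linearZ.
Qed.

Lemma orthogonal_map_unit n (v e : 'cV[R]_n) :
  (v^T *m v) 0 0 = 1 -> (e^T *m e) 0 0 = 1 ->
  exists2 H : 'M[R]_n, H^T *m H = 1%:M & H *m e = v.
Proof.
move=> v1 e1; have [->|ve] := eqVneq v e.
  by exists 1%:M; rewrite ?trmx1 mul1mx.
pose w := e - v; pose k := (w^T *m w) 0 0.
have wT : w^T = e^T - v^T by rewrite /w raddfB.
have wk : w^T *m w = k%:M by rewrite [LHS]mx11_scalar.
have k0 : k != 0 by rewrite /k sqmx_eq0 subr_eq0 eq_sym.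
have we : (w^T *m e) = (k / 2)%:M.
  have ev : (e^T *m v) 0 0 = (v^T *m e) 0 0.
    have -> : e^T *m v = (v^T *m e)^T by rewrite trmx_mul trmxK.
    by rewrite mxE.
  rewrite [LHS]mx11_scalar; congr (_%:M).
  have kE : k = 2 - 2 * (v^T *m e) 0 0.
    rewrite /k wT /w mulmxBl !mulmxBr.
    move: v1 e1 ev; rewrite !mxE => -> -> ->; ring.
  rewrite kE wT mulmxBl; move: e1; rewrite !mxE => ->; by field.
(* the Householder reflection in the hyperplane orthogonal to w *)
pose H := 1%:M - (2 / k) *: (w *m w^T).
have HT : H^T = H.
  by rewrite /H linearB /= trmx1 linearZ /= trmx_mul trmxK.
exists H.
  rewrite HT {1}/H mulmxBl mul1mx /H mulmxBr mulmx1 -scalemxAr -!scalemxAl.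
  rewrite -mulmxA (mulmxA w^T) wk mul_scalar_mx -!scalemxAr.
  rewrite opprB -addrA -[RHS]addr0; congr (_ + _).
  rewrite addrC -addrA -opprD !scalerA -scalerDl -scalerBl -[RHS](scale0r (w *m w^T)).
  by congr (_ *: _); field.
rewrite /H mulmxBl mul1mx -scalemxAl -mulmxA we mul_mx_scalar scalerA.
have -> : 2 / k * (k / 2) = 1 by field.
by rewrite scale1r /w opprB addrC subrK.
Qed.

(** Deflation: conjugating by an orthogonal map that sends the first basis vector to a unit
    eigenvector makes S block diagonal, and the induction hypothesis diagonalizes the remaining
    block. *)
Theorem real_spectral n (S : 'M[R]_n) : S^T = S ->
  exists (U : 'M[R]_n) (d : 'rV[R]_n),
    U^T *m U = 1%:M /\ S = U *m diag_mx d *m U^T.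
Proof.
elim: n S => [|n IHn] S symS.
  exists 1%:M, 0; rewrite trmx1 mulmx1; split=> //.
  by apply/matrixP => -[].
have [a [v [v0 Sv]]] := symmetric_eigenvector symS.
pose c := Num.sqrt ((v^T *m v) 0 0).
have c2 : c ^+ 2 = (v^T *m v) 0 0 by rewrite sqr_sqrtr // sqmx_ge0.
have c0 : c != 0 by rewrite -sqrf_eq0 c2 sqmx_eq0.
pose u := c^-1 *: v.
have Su : S *m u = a *: u by rewrite /u -scalemxAr Sv scalerA mulrC -scalerA.
have u1 : (u^T *m u) 0 0 = 1.
  have -> : u^T = c^-1 *: v^T by rewrite /u [LHS]linearZ.
  by rewrite /u -scalemxAl -scalemxAr scalerA mxE -c2; field.
pose e : 'cV[R]_(1 + n) := col_mx 1%:M 0.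
have e1 : (e^T *m e) 0 0 = 1.
  by rewrite /e tr_col_mx mul_row_col trmx1 mulmx1 mulmx0 addr0 mxE.
have [H HH He] := orthogonal_map_unit u1 e1.
pose S1 : 'M[R]_(1 + n) := H^T *m S *m H.
have symS1 : S1^T = S1 by rewrite /S1 !trmx_mul trmxK symS mulmxA.
have S1e : S1 *m e = a *: e.
  by rewrite /S1 -(mulmxA _ H) He -mulmxA Su -scalemxAr -He mulmxA HH mul1mx.
have S1E : S1 = block_mx (a%:M) 0 0 (drsubmx S1).
  rewrite -[LHS]submxK.
  move: S1e; rewrite -{1}[S1]submxK /e mul_block_col !mulmx1 !mulmx0 !addr0.
  rewrite scale_col_mx scaler0 => /eq_col_mx[-> dl].
  rewrite dl scale_scalar_mx mulr1; congr (block_mx _ _ _ _).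
  move: symS1; rewrite -{1}[S1]submxK tr_block_mx -[in RHS](submxK S1) => /eq_block_mx[_ h _ _].
  by rewrite -h dl trmx0.
have symS2 : (drsubmx S1)^T = drsubmx S1 by rewrite trmx_drsub symS1.
have [U [d [UU UE]]] := IHn _ symS2.
pose V : 'M[R]_(1 + n) := block_mx 1%:M 0 0 U.
have VV : V^T *m V = 1%:M.
  rewrite /V tr_block_mx mulmx_block !trmx0 trmx1 !mulmx0 !mul0mx !mulmx1 !addr0.
  by rewrite UU add0r -scalar_mx_block.
exists (H *m V), (row_mx a%:M d); split.
  transitivity (V^T *m H^T *m (H *m V)); first by congr (_ *m _); exact: trmx_mul.
  by rewrite -mulmxA (mulmxA H^T) HH mul1mx VV.
have S1V : S1 = V *m diag_mx (row_mx a%:M d) *m V^T.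
  rewrite S1E UE diag_mx_row /V tr_block_mx !mulmx_block !trmx0 trmx1.
  rewrite !mulmx0 !mul0mx !mulmx1 !mul1mx !addr0 !add0r.
  congr (block_mx _ _ _ _); last by rewrite mul0mx.
  by apply/matrixP => i j; rewrite !ord1 !mxE eqxx.
have SE : S = H *m S1 *m H^T.
  by rewrite /S1 !mulmxA (mulmx1C HH) mul1mx -mulmxA (mulmx1C HH) mulmx1.
transitivity (H *m V *m diag_mx (row_mx a%:M d) *m (V^T *m H^T)).
  by rewrite SE S1V !mulmxA.
by congr (_ *m _); rewrite [RHS]trmx_mul.
Qed.

End Spectral.

(** * Positive definite matrices *)

Section QuadraticForms.
Variable R : realType.

Lemma posdefmx_psd k (S : 'M[R]_k) : posdefmx S -> psdmx S.
Proof.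
move=> [ST S0]; split=> // v.
have [->|v0] := eqVneq v 0; first by rewrite mulmx0 mxE.
exact/ltW/S0.
Qed.

Lemma quad_mulmx k l (S : 'M[R]_k) (B : 'M[R]_(k, l)) (v : 'cV_l) :
  (v^T *m (B^T *m S *m B) *m v) 0 0 = ((B *m v)^T *m S *m (B *m v)) 0 0.
Proof. by rewrite trmx_mul !mulmxA. Qed.

Lemma psdmx_congr k l (S : 'M[R]_k) (B : 'M[R]_(k, l)) :
  psdmx S -> psdmx (B^T *m S *m B).
Proof.
move=> [ST S0]; split; first by rewrite !trmx_mul trmxK ST mulmxA.
by move=> v; rewrite quad_mulmx.
Qed.

Lemma posdefmxDl k (S S' : 'M[R]_k) : posdefmx S -> psdmx S' -> posdefmx (S + S').
Proof.
move=> [ST S0] [S'T S'0]; split; first by rewrite raddfD /= ST S'T.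
by move=> v v0; rewrite mulmxDr mulmxDl mxE ltr_pwDl // S0.
Qed.

Lemma quad_diag k (U : 'M[R]_k) (d : 'rV[R]_k) (v : 'cV_k) :
  (v^T *m (U *m diag_mx d *m U^T) *m v) 0 0 = \sum_i d 0 i * (U^T *m v) i 0 ^+ 2.
Proof.
have -> : U *m diag_mx d *m U^T = (U^T)^T *m diag_mx d *m U^T by rewrite trmxK.
rewrite quad_mulmx -mulmxA mxE; apply: eq_bigr => i _.
by rewrite mul_diag_mx !mxE mulrCA expr2.
Qed.

Lemma quad_id k (v : 'cV[R]_k) : (v^T *m v) 0 0 = \sum_i v i 0 ^+ 2.
Proof. by rewrite mxE; apply: eq_bigr => i _; rewrite mxE expr2. Qed.

Lemma quad_orth k (U : 'M[R]_k) (v : 'cV_k) : U^T *m U = 1%:M ->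
  \sum_i (U^T *m v) i 0 ^+ 2 = \sum_i v i 0 ^+ 2.
Proof.
move=> UU; rewrite -!quad_id trmx_mul trmxK mulmxA -(mulmxA v^T).
by rewrite (mulmx1C UU) mulmx1.
Qed.

Lemma spectral_col k (S U : 'M[R]_k) (d : 'rV[R]_k) i :
  U^T *m U = 1%:M -> S = U *m diag_mx d *m U^T ->
  S *m col i U = d 0 i *: col i U.
Proof.
move=> UU ->; rewrite -!mulmxA.
have -> : U^T *m col i U = delta_mx i 0.
  by rewrite colE mulmxA UU mul1mx.
have -> : diag_mx d *m delta_mx i 0 = d 0 i *: delta_mx i 0 :> 'cV_k.
  apply/matrixP => a b; rewrite mul_diag_mx !mxE.
  by case: (eqVneq a i) => [->//|]; rewrite !mulr0.
by rewrite -scalemxAr colE.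
Qed.

Lemma col_unit k (U : 'M[R]_k) i : U^T *m U = 1%:M ->
  ((col i U)^T *m col i U) 0 0 = 1.
Proof.
move=> UU; rewrite colE trmx_mul mulmxA -(mulmxA _ U^T) UU mulmx1 trmx_delta.
by rewrite mul_delta_mx mxE !eqxx.
Qed.

Lemma quad_col k (S U : 'M[R]_k) (d : 'rV[R]_k) i :
  U^T *m U = 1%:M -> S = U *m diag_mx d *m U^T ->
  ((col i U)^T *m S *m col i U) 0 0 = d 0 i.
Proof.
move=> UU SE; rewrite -mulmxA (spectral_col i UU SE) -scalemxAr mxE.
by rewrite (col_unit i UU) mulr1.
Qed.

Lemma col_orth_neq0 k (U : 'M[R]_k) i : U^T *m U = 1%:M -> col i U != 0.
Proof.
move=> UU; apply: contra_eq_neq (col_unit i UU) => ->.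
by rewrite mulmx0 mxE eq_sym oner_neq0.
Qed.

Lemma posdefmx_spectral k (S : 'M[R]_k) : posdefmx S ->
  exists (U : 'M[R]_k) (d : 'rV[R]_k),
    [/\ U^T *m U = 1%:M, S = U *m diag_mx d *m U^T & forall i, 0 < d 0 i].
Proof.
move=> [ST S0]; have [U [d [UU SE]]] := real_spectral ST.
exists U, d; split=> // i.
by rewrite -(quad_col i UU SE) S0 // col_orth_neq0.
Qed.

(** [xget] returns a member of any nonempty set, so one root has to be exhibited: the roots of the
    eigenvalues in an orthonormal eigenbasis. *)
Lemma sqrtmxP k (S : 'M[R]_k) : psdmx S ->
  psdmx (sqrtmx S) /\ sqrtmx S *m sqrtmx S = S.
Proof.
move=> [ST S0].
suff : [set Q : 'M[R]_k | psdmx Q /\ Q *m Q = S] (sqrtmx S) by [].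
apply: xgetPex.
have [U [d [UU SE]]] := real_spectral ST.
have d0 i : 0 <= d 0 i by rewrite -(quad_col i UU SE).
exists (U *m diag_mx (map_mx Num.sqrt d) *m U^T); split; first split.
- by rewrite !trmx_mul trmxK tr_diag_mx mulmxA.
- move=> v; rewrite quad_diag sumr_ge0 // => i _.
  by rewrite mulr_ge0 ?sqr_ge0 // mxE sqrtr_ge0.
- rewrite !mulmxA -(mulmxA _ U^T U) UU mulmx1 SE; congr (_ *m _).
  rewrite -mulmxA mulmx_diag; congr (_ *m diag_mx _).
  by apply/rowP => i; rewrite !mxE -expr2 sqr_sqrtr.
Qed.

Lemma unitmx_inj k (S : 'M[R]_k) :
  (forall v : 'cV_k, S *m v = 0 -> v = 0) -> S \in unitmx.
Proof.
move=> Sinj; rewrite -unitmx_tr -row_free_unit -kermx_eq0.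
apply/eqP/row_matrixP => i; rewrite row0.
have : row i (kermx S^T) *m S^T = 0 by rewrite -row_mul mulmx_ker row0.
move=> /(congr1 trmx); rewrite trmx_mul trmxK trmx0 => /Sinj /(congr1 trmx).
by rewrite trmxK trmx0.
Qed.

Lemma posdefmx_unit k (S : 'M[R]_k) : posdefmx S -> S \in unitmx.
Proof.
move=> [_ S0]; apply: unitmx_inj => v Sv; apply/eqP/contraT => /S0.
by rewrite -mulmxA Sv mulmx0 mxE ltxx.
Qed.

(** With Q the square root of S, the form is |Q v|^2. If it vanishes then S v = Q (Q v) = 0, hence v
    = 0. *)
Lemma psdmx_unit_posdef k (S : 'M[R]_k) : psdmx S -> S \in unitmx -> posdefmx S.
Proof.
move=> Spsd Su; have [[QT _] QQ] := sqrtmxP Spsd; have [ST S0] := Spsd.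
split=> // v v0; rewrite lt_def S0 andbT; apply: contra v0.
rewrite -QQ -{1}QT.
have -> : (v^T *m ((sqrtmx S)^T *m sqrtmx S) *m v) 0 0 =
  ((sqrtmx S *m v)^T *m (sqrtmx S *m v)) 0 0 by rewrite trmx_mul !mulmxA.
rewrite sqmx_eq0 => /eqP Qv; apply/eqP.
by rewrite -(mulKmx Su v) -[X in _ *m (X *m v)]QQ -mulmxA Qv !mulmx0.
Qed.

Lemma sqrtmx_unit k (S : 'M[R]_k) : posdefmx S -> sqrtmx S \in unitmx.
Proof.
move=> Spd; have [_ QQ] := sqrtmxP (posdefmx_psd Spd).
have := posdefmx_unit Spd; rewrite -[X in X \in _]QQ unitmx_mul => /andP[] //.
Qed.

Lemma posdefmx_inv k (S : 'M[R]_k) : posdefmx S -> posdefmx (invmx S).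
Proof.
move=> Spd; have Su := posdefmx_unit Spd; have [ST S0] := Spd.
split; first by rewrite trmx_inv ST.
move=> v v0; pose w := invmx S *m v.
have vw : v = S *m w by rewrite mulKVmx.
have -> : (v^T *m invmx S *m v) 0 0 = (w^T *m S *m w) 0 0.
  by rewrite vw trmx_mul ST -!mulmxA mulKmx // !mulmxA.
by apply: S0; apply: contra_neq v0 => w0; rewrite vw w0 mulmx0.
Qed.

Lemma posdefmx_tr_gt0 k (S : 'M[R]_k) : (0 < k)%N -> posdefmx S -> 0 < \tr S.
Proof.
case: k S => // k S _ [_ S0].
have Sii i : 0 < S i i.
  have := S0 (delta_mx i 0).
  rewrite trmx_delta -rowE -colE !mxE; apply.
  by apply/eqP => /matrixP/(_ i 0); rewrite !mxE !eqxx => /eqP; rewrite oner_eq0.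
rewrite /mxtrace big_ord_recl; apply: ltr_pwDl => //.
by apply: sumr_ge0 => i _; exact/ltW.
Qed.

Lemma tr_spectral k (S U : 'M[R]_k) (d : 'rV[R]_k) :
  U^T *m U = 1%:M -> S = U *m diag_mx d *m U^T ->
  \tr S = \sum_i d 0 i /\ \tr (S *m S) = \sum_i d 0 i ^+ 2.
Proof.
move=> UU ->; split.
  by rewrite mxtrace_mulC mulmxA UU mul1mx mxtrace_diag.
rewrite mxtrace_mulC !mulmxA -(mulmxA _ U^T U) UU mulmx1.
rewrite -(mulmxA _ _ (diag_mx d)) mulmx_diag mxtrace_mulC mulmxA UU mul1mx mxtrace_diag.
by apply: eq_bigr => i _; rewrite mxE expr2.
Qed.

Lemma norm2_sqr k (v : 'cV[R]_k) : norm2 v ^+ 2 = (v^T *m v) 0 0.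
Proof. by rewrite /norm2 -quad_id sqr_sqrtr // sqmx_ge0. Qed.

Lemma norm2_ge0 k (v : 'cV[R]_k) : 0 <= norm2 v.
Proof. exact: sqrtr_ge0. Qed.

(** Evaluating at the i-th unit eigenvector gives |d_i|. This lets the spectral norm of C stand in
    for its eigenvalues in the Chernoff bound. *)
Lemma spectral_norm_ge k (S U : 'M[R]_k) (d : 'rV[R]_k) i :
  U^T *m U = 1%:M -> S = U *m diag_mx d *m U^T ->
  d 0 i <= spectral_norm S.
Proof.
move=> UU SE; pose u := col i U.
have nu : norm2 u = 1.
  by apply/eqP; rewrite -(@eqrXn2 _ 2) ?norm2_ge0 // norm2_sqr col_unit // expr1n.
have nSu : norm2 (S *m u) = `|d 0 i|.
  apply/eqP; rewrite -(@eqrXn2 _ 2) ?norm2_ge0 // norm2_sqr (spectral_col i UU SE) real_normK ?num_real //.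
  by rewrite [_^T]linearZ /= -scalemxAl -scalemxAr 2!mxE col_unit // mulr1 expr2.
rewrite (le_trans (ler_norm _)) // -nSu; apply: sup_upper_bound; last by exists u.
split; first by exists (norm2 (S *m u)), u.
(* A supremum dominates its members only if the set is bounded. This crude bound works because every
   coordinate of a unit vector in the eigenbasis has square at most 1. *)
exists (Num.sqrt (\sum_j d 0 j ^+ 2)) => _ [v v1 <-].
rewrite -(@ler_pXn2r _ 2) ?nnegrE ?norm2_ge0 ?sqrtr_ge0 // norm2_sqr sqr_sqrtr; last first.
  by apply: sumr_ge0 => j _; exact: sqr_ge0.
have v1' : \sum_j (U^T *m v) j 0 ^+ 2 = 1.
  by rewrite quad_orth // -quad_id -norm2_sqr v1 expr1n.
have -> : (S *m v)^T *m (S *m v) = v^T *m (U *m diag_mx (map_mx (fun x => x ^+ 2) d) *m U^T) *m v.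
  rewrite SE !trmx_mul trmxK tr_diag_mx !mulmxA; congr (_ *m _); congr (_ *m _).
  rewrite -(mulmxA _ U^T U) UU mulmx1 -!mulmxA; congr (_ *m (_ *m _)).
  by rewrite mulmx_diag; congr diag_mx; apply/rowP => j; rewrite !mxE expr2.
rewrite quad_diag; apply: ler_sum => j _; rewrite mxE ler_piMr ?sqr_ge0 //.
rewrite -v1' (bigD1 j) //= lerDl; apply: sumr_ge0 => l _; exact: sqr_ge0.
Qed.

(** Each eigenvalue of W^T W has a singular value as its root, so all of them are at least s^2; the
    form is then compared in the eigenbasis. *)
Lemma sigma_min_quad n k (W : 'M[R]_(n, k)) s : 0 <= s -> s <= sigma_min W ->
  forall v : 'cV_k, s ^+ 2 * (v^T *m v) 0 0 <= (v^T *m (W^T *m W) *m v) 0 0.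
Proof.
move=> s0 sW v.
have GT : (W^T *m W)^T = W^T *m W by rewrite trmx_mul trmxK.
have [U [d [UU GE]]] := real_spectral GT.
have sd i : s ^+ 2 <= d 0 i.
  have d0 : 0 <= d 0 i.
    rewrite -(quad_col i UU GE) mulmxA -trmx_mul -mulmxA; exact: sqmx_ge0.
  rewrite -[leRHS]sqr_sqrtr // ler_pXn2r ?nnegrE ?sqrtr_ge0 //.
  apply: le_trans sW _; apply: inf_lbound; last first.
    split; first exact: sqrtr_ge0.
    rewrite sqr_sqrtr //; apply/eigenvalueP; exists (col i U)^T.
      by rewrite -GT -trmx_mul (spectral_col i UU GE) [LHS]linearZ.
    by rewrite trmx_eq0 col_orth_neq0.
  by exists 0 => x [].
rewrite GE quad_diag quad_id -(quad_orth v UU) mulr_sumr.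
by apply: ler_sum => i _; rewrite ler_wpM2r ?sqr_ge0.
Qed.

End QuadraticForms.

(** * Linear estimation *)

Section LinearEstimation.
Variable R : realType.

Lemma normF_sqr m n (A : 'M[R]_(m, n)) : normF A ^+ 2 = \tr (A^T *m A).
Proof.
rewrite /normF sqr_sqrtr; last first.
  by apply: sumr_ge0 => i _; apply: sumr_ge0 => j _; exact: sqr_ge0.
rewrite exchange_big; apply: eq_bigr => j _; rewrite mxE.
by apply: eq_bigr => i _; rewrite mxE expr2.
Qed.

Lemma normF_ge0 m n (A : 'M[R]_(m, n)) : 0 <= normF A.
Proof. exact: sqrtr_ge0. Qed.

Lemma normF_eq0 m n (A : 'M[R]_(m, n)) : normF A = 0 -> A = 0.
Proof.
move=> A0; have : normF A ^+ 2 = 0 by rewrite A0 expr0n.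
rewrite /normF sqr_sqrtr; last first.
  by apply: sumr_ge0 => i _; apply: sumr_ge0 => j _; exact: sqr_ge0.
move/eqP; rewrite psumr_eq0; last by move=> i _; apply: sumr_ge0 => j _; exact: sqr_ge0.
move=> /allP h; apply/matrixP => i j; rewrite mxE.
have := h i (mem_index_enum _); rewrite /= psumr_eq0; last by move=> l _; exact: sqr_ge0.
by move=> /allP/(_ j (mem_index_enum _)); rewrite /= sqrf_eq0 => /eqP.
Qed.

Lemma normF_orth m n (A : 'M[R]_(m, n)) (U : 'M[R]_n) :
  U *m U^T = 1%:M -> normF (A *m U) = normF A.
Proof.
move=> UU; apply/eqP; rewrite -(@eqrXn2 _ 2) ?normF_ge0 // !normF_sqr.
by rewrite mxtrace_mulC trmx_mul !mulmxA -(mulmxA A) UU mulmx1 mxtrace_mulC.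
Qed.

(** With K = A^T CZ^-1 A + CX^-1, both K CX A^T and A^T CZ^-1 CY equal A^T CZ^-1 A CX A^T + A^T,
    which gives the first identity. The error covariance is K^-1, whence its positivity. *)
Lemma lmmse_mxP (N M : nat) (A : 'M[R]_(M, N)) (CX : 'M[R]_N) (CZ : 'M[R]_M) :
  posdefmx CX -> posdefmx CZ ->
  let CY := A *m CX *m A^T + CZ in
  let Th := lmmse_mx A CX CZ in
  [/\ Th^T *m CY = CX *m A^T,
      error_covmx A CX CZ = CX - Th^T *m A *m CX &
      posdefmx (error_covmx A CX CZ)].
Proof.
move=> CXp CZp CY Th.
have CXu := posdefmx_unit CXp; have CZu := posdefmx_unit CZp.
have Ap : psdmx (A^T *m invmx CZ *m A).
  exact/psdmx_congr/posdefmx_psd/posdefmx_inv.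
have Kp : posdefmx (A^T *m invmx CZ *m A + invmx CX).
  by rewrite addrC; apply: posdefmxDl => //; exact: posdefmx_inv.
set K := (_ + invmx CX) in Kp; have Ku := posdefmx_unit Kp.
have CYp : posdefmx CY.
  rewrite /CY addrC; apply: posdefmxDl => //.
  have := @psdmx_congr _ _ _ CX A^T (posdefmx_psd CXp); by rewrite trmxK.
have CYu := posdefmx_unit CYp.
have ThE : Th^T = invmx K *m A^T *m invmx CZ by rewrite /Th /lmmse_mx trmxK.
have e1 : Th^T *m CY = CX *m A^T.
  rewrite ThE -[RHS](mulKmx Ku) -!mulmxA; congr (_ *m _).
  rewrite /K /CY mulmxDr mulVmx // !mulmxDl !mulmxDr mulmx1 !mulmxA.
  by rewrite mulVmx // mul1mx.
have e2 : error_covmx A CX CZ = CX - Th^T *m A *m CX.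
  rewrite /error_covmx -/CY -e1 -(mulmxA _ CY) mulmxV //.
  by rewrite mulmx1.
split=> //.
suff -> : error_covmx A CX CZ = invmx K by exact: posdefmx_inv.
rewrite -[LHS](mulKmx Ku) e2 ThE mulmxBr.
rewrite -!mulmxA (mulKVmx Ku) /K mulmxDl mulVmx // -!mulmxA addrAC subrr add0r.
by rewrite mulmx1.
Qed.

(** Completion of the square. For uncorrelated X and Z the left side is the covariance of Th^T Y -
    X, so the last term is the excess over the optimal error. *)
Lemma lmmse_mx_opt (N M : nat) (A : 'M[R]_(M, N)) (CX : 'M[R]_N) (CZ : 'M[R]_M)
    (Th : 'M[R]_(M, N)) :
  posdefmx CX -> posdefmx CZ ->
  let CY := A *m CX *m A^T + CZ in
  let D := Th - lmmse_mx A CX CZ in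
  (Th^T *m A - 1%:M) *m CX *m (Th^T *m A - 1%:M)^T + Th^T *m CZ *m Th =
  error_covmx A CX CZ + D^T *m CY *m D.
Proof.
move=> CXp CZp CY D; have [e1 e2 _] := lmmse_mxP A CXp CZp.
rewrite -/CY in e1.
have [CXT _] := CXp; have [CZT _] := CZp.
have CYT : CY^T = CY by rewrite /CY raddfD /= !trmx_mul trmxK CXT CZT mulmxA.
have e3 : CY *m lmmse_mx A CX CZ = A *m CX.
  by apply: trmx_inj; rewrite trmx_mul CYT e1 trmx_mul CXT.
have DT : D^T = Th^T - (lmmse_mx A CX CZ)^T by rewrite /D raddfB.
have LT : (Th^T *m A - 1%:M)^T = A^T *m Th - 1%:M.
  by rewrite raddfB /= trmx_mul trmxK trmx1.
have DD : D^T *m CY *m D = Th^T *m CY *m Th - CX *m A^T *m Th -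
    (Th^T *m A *m CX - CX *m A^T *m lmmse_mx A CX CZ).
  by rewrite DT mulmxBl e1 /D mulmxBr !mulmxBl -(mulmxA _ CY (lmmse_mx A CX CZ)) e3 !mulmxA.
rewrite e2 DD LT.
have -> : CX *m A^T *m lmmse_mx A CX CZ = (lmmse_mx A CX CZ)^T *m A *m CX.
  by rewrite -e1 -mulmxA e3 mulmxA.
rewrite !mulmxBl !mulmxBr !mulmx1 !mul1mx /CY mulmxDr mulmxDl !mulmxA.
set a := _ *m CX *m A^T *m Th; set b := Th^T *m A *m CX; set c := CX *m A^T *m Th.
set e := Th^T *m CZ *m Th; set f := _ *m A *m CX.
apply/eqP; rewrite -subr_eq0; apply/eqP/matrixP => i j; rewrite !mxE; ring.
Qed.

(** The candidate [Th1] has a residual orthogonal to the range of Y. By Pythagoras every other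
    minimizer differs from it by a matrix that Y kills, hence by 0. *)
Lemma least_squares_unique (n N M : nat) (Y W : 'M[R]_(n, M)) (X : 'M[R]_(n, N))
    (S : 'M[R]_M) (Th Th0 : 'M[R]_(M, N)) :
  (0 < n)%N -> S^T = S -> S \in unitmx -> Y = W *m S -> W^T *m W \in unitmx ->
  least_squares Y X Th ->
  S *m (Th - Th0) = invmx (W^T *m W) *m W^T *m (X - Y *m Th0).
Proof.
move=> n0 ST Su YE Gu LS; set B := invmx _ *m W^T.
have BW : B *m W = 1%:M by rewrite /B -mulmxA mulVmx.
pose Th1 := invmx S *m B *m X.
have YTh1 : Y *m Th1 = W *m B *m X by rewrite YE /Th1 -!mulmxA mulKVmx.
have orth : Y^T *m (Y *m Th1 - X) = 0.
  have WB : W^T *m (W *m B *m X) = W^T *m X.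
    by rewrite /B !mulmxA mulmxV // mul1mx.
  by rewrite YTh1 YE trmx_mul -(mulmxA S^T) mulmxBr WB subrr mulmx0.
have dec : normF (Y *m Th - X) ^+ 2 =
    normF (Y *m (Th - Th1)) ^+ 2 + normF (Y *m Th1 - X) ^+ 2.
  have -> : Y *m Th - X = Y *m (Th - Th1) + (Y *m Th1 - X).
    by rewrite mulmxBr addrA subrK.
  set a := Y *m (Th - Th1); set b := Y *m Th1 - X.
  have ab : a^T *m b = 0 by rewrite /a trmx_mul -mulmxA orth mulmx0.
  have ba : b^T *m a = 0 by apply: trmx_inj; rewrite trmx_mul trmxK ab !trmx0.
  have abT : (a + b)^T = a^T + b^T by rewrite raddfD.
  rewrite !normF_sqr abT mulmxDl (mulmxDr a^T a b) (mulmxDr b^T a b) ab ba addr0 add0r.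
  by rewrite raddfD.
(* For n = 0 the factor would be 0 and minimality would say nothing. *)
have n1 : 0 < n%:R^-1 :> R by rewrite invr_gt0 ltr0n.
have := LS Th1; rewrite ler_pM2l // dec gerDr => h.
have YD : Y *m (Th - Th1) = 0.
  apply: normF_eq0; apply/eqP; rewrite -sqrf_eq0; apply/eqP/le_anti.
  by rewrite h sqr_ge0.
have D0 : Th = Th1.
  apply/eqP; rewrite -subr_eq0; apply/eqP.
  rewrite -(mulKmx Su (Th - Th1)) -[S *m _]mul1mx -BW -(mulmxA B) (mulmxA W) -YE.
  by rewrite YD !mulmx0.
rewrite D0 mulmxBr /Th1 -!mulmxA mulKVmx // (mulmxBr _ X) mulmxBr -/B !mulmxA.
by rewrite -/B YE (mulmxA B) BW mul1mx.
Qed.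

Lemma quad_lower_unit n k (W : 'M[R]_(n, k)) s : 0 < s ->
  (forall v : 'cV_k, s ^+ 2 * (v^T *m v) 0 0 <= (v^T *m (W^T *m W) *m v) 0 0) ->
  W^T *m W \in unitmx.
Proof.
move=> s0 sW; apply: unitmx_inj => v Gv; apply/eqP/contraT => v0.
have := sW v; rewrite -(mulmxA v^T) Gv mulmx0 [X in _ <= X]mxE leNgt.
by rewrite mulr_gt0 ?exprn_gt0 // sqmx_gt0.
Qed.

(* With B = (W^T W)^-1 W^T one has B B^T = (W^T W)^-1, so that the lower bound
   s^2 on W^T W becomes the upper bound s^-2 on B B^T. *)
Lemma pinv_quad_le n k (W : 'M[R]_(n, k)) s (v : 'cV[R]_k) (b : 'cV_n) :
  0 < s ->
  (forall v : 'cV_k, s ^+ 2 * (v^T *m v) 0 0 <= (v^T *m (W^T *m W) *m v) 0 0) ->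
  b = (invmx (W^T *m W) *m W^T)^T *m v ->
  (b^T *m b) 0 0 <= s ^- 2 * (v^T *m v) 0 0.
Proof.
move=> s0 sW; have Gu := quad_lower_unit s0 sW; set G := W^T *m W in Gu *.
have GT : G^T = G by rewrite /G trmx_mul trmxK.
move=> bdef; pose u := invmx G *m v.
have bE : b = W *m u by rewrite bdef trmx_mul trmxK trmx_inv GT -mulmxA.
have vE : v = G *m u by rewrite mulKVmx.
have bb : (b^T *m b) 0 0 = (u^T *m v) 0 0.
  by rewrite bE vE /G trmx_mul !mulmxA.
have uv0 : 0 <= (u^T *m v) 0 0 by rewrite -bb sqmx_ge0.
have su : s ^+ 2 * (u^T *m u) 0 0 <= (u^T *m v) 0 0.
  by rewrite vE (mulmxA u^T G u); exact: sW.
rewrite bb ler_pdivlMl ?exprn_gt0 //.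
have dT : (v - s ^+ 2 *: u)^T = v^T - s ^+ 2 *: u^T by rewrite raddfB /= linearZ.
have vu : (v^T *m u) 0 0 = (u^T *m v) 0 0.
  have -> : v^T *m u = (u^T *m v)^T by rewrite trmx_mul trmxK.
  by rewrite mxE.
(* Expanding |v - s^2 u|^2 >= 0 gives 2 s^2 u.v <= |v|^2 + s^4 |u|^2, and s^2 |u|^2 <= u.v removes
   the last term. *)
have := sqmx_ge0 (v - s ^+ 2 *: u).
have -> : ((v - s ^+ 2 *: u)^T *m (v - s ^+ 2 *: u)) 0 0 =
    (v^T *m v) 0 0 - s ^+ 2 * (u^T *m v) 0 0
    - s ^+ 2 * ((v^T *m u) 0 0 - s ^+ 2 * (u^T *m u) 0 0).
  rewrite dT mulmxBl !mulmxBr -!scalemxAl -!scalemxAr.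
  move: (v^T *m v) (u^T *m v) (v^T *m u) (u^T *m u) => a b' c' d; rewrite !mxE; ring.
rewrite vu; have s20 : 0 <= s ^+ 2 by exact: sqr_ge0.
move: su uv0; set p := (v^T *m v) 0 0; set q := (u^T *m v) 0 0.
set t := (u^T *m u) 0 0 => su uv0.
have := ler_wpM2l s20 su.
nra.
Qed.

End LinearEstimation.

(** * Gaussian linearization *)

Section Scalar.
Variable R : realType.

(** The difference of the two sides vanishes at 0 and has derivative (e^t - 1)^2 / e^t. At x = - ln
    y it bounds the logarithm in [invsqrt_le_expR]. *)
Lemma sinh_ge (x : R) : 0 <= x -> 2 * x <= expR x - expR (- x).
Proof.
move=> x0; pose f (t : R) := expR t - expR (- t) - 2 * t.
have df (t : R) : is_derive t 1 f (expR t + expR (- t) - 2).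
  rewrite /f; apply: is_derive_eq; rewrite /GRing.scale /=; ring.
have cf (t : R) : derivable f t 1 by [].
have -> : (2 * x <= expR x - expR (- x)) = (f 0 <= f x).
  by rewrite /f oppr0 subrr sub0r mulr0 oppr0 subr_ge0.
apply: (@ger0_derive1_le_cc _ f 0 x) => //; last 2 first.
- by rewrite in_itv /= lexx.
- by rewrite in_itv /= lexx x0.
- move=> t _; rewrite derive1E derive_val.
  rewrite subr_ge0 expRN.
  have e0 := expR_gt0 t; set e := expR t in e0 *.
  rewrite -subr_ge0 -(pmulr_rge0 _ e0) mulrBr mulrDr divff ?gt_eqF //.
  have -> : e * e + 1 - e * 2 = (e - 1) ^+ 2 by ring.
  exact: sqr_ge0.
- apply: continuous_subspaceT => t; exact/differentiable_continuous/derivable1_diffP.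
Qed.

(** The left side is the exponential moment of a squared standard Gaussian at u. With y = 1 - 2 u
    the exponent on the right is (1/y - y) / 4, and the claim is [sinh_ge] at - ln y. *)
Lemma invsqrt_le_expR (u : R) : 2 * u < 1 ->  0 <= u ->
  (Num.sqrt (1 - 2 * u))^-1 <= expR (u + u ^+ 2 / (1 - 2 * u)).
Proof.
move=> u1 u0; set y := 1 - 2 * u.
have y0 : 0 < y by rewrite /y subr_gt0.
have y1 : y <= 1 by rewrite /y lerBlDr lerDl mulr_ge0.
have sy0 : 0 < Num.sqrt y by rewrite sqrtr_gt0.
have uE : u = (1 - y) / 2 by rewrite /y; field.
have -> : u + u ^+ 2 / y = (y^-1 - y) / 4.
  by rewrite uE; field; rewrite gt_eqF.
rewrite -(@ler_pXn2r _ 2) // ?nnegrE ?invr_ge0 ?sqrtr_ge0 ?expR_ge0 //.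
rewrite exprVn sqr_sqrtr ?(ltW y0) //.
rewrite -expRM_natl -[leLHS]lnK ?posrE ?invr_gt0 // ler_expR.
have ly0 : 0 <= ln y^-1 by rewrite ln_ge0 // invf_ge1.
have := sinh_ge ly0.
rewrite -lnV ?posrE ?invr_gt0 // invrK !lnK ?posrE ?invr_gt0 //; lra.
Qed.

Lemma gaussian_mgf (a : R) :
  (\int[lebesgue_measure]_x (expR (a * x) * normal_pdf 0 1 x)%:E
    = (expR (a ^+ 2 / 2))%:E)%E.
Proof.
transitivity (\int[lebesgue_measure]_x ((expR (a ^+ 2 / 2))%:E * (normal_pdf a 1 x)%:E))%E.
  apply: eq_integral => x _; rewrite -EFinM; congr (_%:E).
  rewrite !normal_pdfE ?oner_neq0 // mulrCA [RHS]mulrCA; congr (_ * _).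
  rewrite /normal_fun -!expRD; congr expR; by field.
rewrite ge0_integralZl_EFin ?expR_ge0 //; last 2 first.
- by move=> x _; rewrite lee_fin normal_pdf_ge0.
- apply/measurable_EFinP; exact: measurable_normal_pdf.
by rewrite integral_normal_pdf mule1.
Qed.

Lemma gaussian_sqr_mgf (k : R) : k < 1 ->
  (\int[lebesgue_measure]_x (expR (k * x ^+ 2 / 2) * normal_pdf 0 1 x)%:E
    = ((Num.sqrt (1 - k))^-1)%:E)%E.
Proof.
move=> k1; pose s := (Num.sqrt (1 - k))^-1.
have k0 : 0 < 1 - k by rewrite subr_gt0.
have s0 : 0 < s by rewrite invr_gt0 sqrtr_gt0.
have s2 : s ^+ 2 = (1 - k)^-1 by rewrite exprVn sqr_sqrtr ?ltW.
transitivity (\int[lebesgue_measure]_x (s%:E * (normal_pdf 0 s x)%:E))%E.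
  apply: eq_integral => x _; rewrite -EFinM; congr (_%:E).
  rewrite !normal_pdfE ?oner_neq0 ?(gt_eqF s0) // mulrCA [RHS]mulrA; congr (_ * _).
    rewrite /normal_peak expr1n mul1r s2 -mulrnAr sqrtrM ?invr_ge0 ?ltW //.
    by rewrite sqrtrV ?ltW // invfM invrK mulrA /s mulVf ?mul1r // gt_eqF // sqrtr_gt0.
  rewrite /normal_fun -!expRD; congr expR; rewrite s2; field.
  by rewrite gt_eqF.
rewrite ge0_integralZl_EFin ?(ltW s0) //; last 2 first.
- by move=> x _; rewrite lee_fin normal_pdf_ge0.
- apply/measurable_EFinP; exact: measurable_normal_pdf.
by rewrite integral_normal_pdf mule1.
Qed.

(** Rewriting 1/x as x (x^2)^-1 reduces the claim to a real power of a nonnegative base; at 0 both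
    sides are 0. *)
Lemma measurable_invr : measurable_fun [set: R] (fun x : R => x^-1).
Proof.
have -> : (fun x : R => x^-1) = (fun x => x * (x ^+ 2) `^ (-1)).
  apply/funext => x; have [->|x0] := eqVneq x 0; first by rewrite invr0 mul0r.
  by rewrite powR_inv1 ?sqr_ge0 // expr2 invfM mulrA divff // mul1r.
apply: measurable_funM => //.
apply: (@measurableT_comp _ _ _ _ _ _ (fun x : R => x `^ (-1)) _ (fun x : R => x ^+ 2)).
  exact: measurable_powR.
exact: measurable_funX.
Qed.

End Scalar.

Section Linearization.
Context d (T : measurableType d) (R : realType) (P : probability T R).

(* exp (eta z^2) is the moment generating function of a standard Gaussian at
   sqrt (2 eta) z. *)
Lemma gaussian_linearization (h z : T -> R) (c k eta : R) :
  measurable_fun setT h -> (forall w, 0 <= h w) -> measurable_fun setT z ->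
  0 <= c -> 0 <= eta -> 2 * eta * k < 1 ->
  (forall x : R, (\int[P]_w (h w * expR (x * z w))%:E <=
                  (c * expR (k * x ^+ 2 / 2))%:E)%E) ->
  (\int[P]_w (h w * expR (eta * z w ^+ 2))%:E <=
    (c * (Num.sqrt (1 - 2 * eta * k))^-1)%:E)%E.
Proof.
move=> mh h0 mz c0 eta0 kk H.
pose r := Num.sqrt (2 * eta).
have r2 : r ^+ 2 = 2 * eta by rewrite sqr_sqrtr // mulr_ge0.
pose f (p : T * R) : \bar R :=
  (h p.1 * expR (p.2 * (r * z p.1)) * normal_pdf 0 1 p.2)%:E.
have mf : measurable_fun setT f.
  apply/measurable_EFinP; apply: measurable_funM; last first.
    by apply: (measurableT_comp (measurable_normal_pdf 0 1)); exact: measurable_snd.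
  apply: measurable_funM; first exact: (measurableT_comp mh measurable_fst).
  apply: (measurableT_comp (@measurable_expR R)).
  apply: measurable_funM; first exact: measurable_snd.
  apply: measurable_funM; first exact: measurable_cst.
  exact: (measurableT_comp mz measurable_fst).
have f0 p : (0 <= f p)%E.
  by rewrite lee_fin !mulr_ge0 ?expR_ge0 ?normal_pdf_ge0.
have -> : (\int[P]_w (h w * expR (eta * z w ^+ 2))%:E =
           \int[P]_w \int[lebesgue_measure]_x f (w, x))%E.
  apply: eq_integral => w _; rewrite /f /=.
  transitivity (\int[lebesgue_measure]_x
      ((h w)%:E * (expR ((r * z w) * x) * normal_pdf 0 1 x)%:E))%E; last first.
    by apply: eq_integral => x _; rewrite -EFinM mulrA (mulrC x).
  rewrite ge0_integralZl_EFin //; last 2 first.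
  - by move=> x _; rewrite lee_fin mulr_ge0 ?expR_ge0 ?normal_pdf_ge0.
  - apply/measurable_EFinP/measurable_funM; last exact: measurable_normal_pdf.
    apply: (measurableT_comp (@measurable_expR R)).
    exact: measurable_funM.
  rewrite gaussian_mgf -EFinM; congr (_ * expR _)%:E.
  by rewrite exprMn r2; field.
(* With the Gaussian variable x outside, the hypothesis applies at [x * r] for each fixed x. What
   remains is the Gaussian mean of exp (2 eta k x^2 / 2), finite as 2 eta k < 1. *)
rewrite (@fubini_tonelli _ _ _ _ R P (@lebesgue_measure R) f) //.
rewrite EFinM.
rewrite -gaussian_sqr_mgf // -ge0_integralZl_EFin //; last 2 first.
- by move=> x _; rewrite lee_fin mulr_ge0 ?expR_ge0 ?normal_pdf_ge0.
- apply/measurable_EFinP/measurable_funM; last exact: measurable_normal_pdf.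
  apply: (measurableT_comp (@measurable_expR R)).
  by apply: measurable_funM => //; apply: measurable_funM => //.
apply: ge0_le_integral => //.
- by move=> x _; apply: integral_ge0 => w _; exact: f0.
- exact: (measurable_fun_fubini_tonelli_G f).
- apply: measurable_funeM; apply/measurable_EFinP/measurable_funM; last exact: measurable_normal_pdf.
  apply: (measurableT_comp (@measurable_expR R)).
  by apply: measurable_funM => //; apply: measurable_funM => //.
move=> x _; rewrite /f /=.
have -> : (\int[P]_x0 (h x0 * expR (x * (r * z x0)) * normal_pdf 0 1 x)%:E =
   (\int[P]_x0 (h x0 * expR ((x * r) * z x0))%:E) * (normal_pdf 0 1 x)%:E)%E.
  rewrite -ge0_integralZr //; last 3 first.
  - apply/measurable_EFinP/measurable_funM => //.
    by apply: (measurableT_comp (@measurable_expR R)); exact: measurable_funM.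
  - by move=> w _; rewrite lee_fin mulr_ge0 ?expR_ge0.
  - by rewrite lee_fin normal_pdf_ge0.
  by apply: eq_integral => w _; rewrite -EFinM mulrA.
rewrite EFinM muleA; apply: lee_wpmul2r; first by rewrite lee_fin normal_pdf_ge0.
apply: le_trans (H (x * r)) _.
rewrite -EFinM lee_fin le_eqVlt; apply/orP; left; apply/eqP.
by congr (_ * expR _); rewrite exprMn r2; field.
Qed.

(** The weight [h] is arbitrary so that the induction can absorb into it the squared exponential of
    the entry already treated. The hypothesis is joint in all entries, so they may be dependent. *)
Lemma gaussian_linearization_seq (I : eqType) (r : seq I) (z : I -> T -> R)
    (k : I -> R) (eta : R) (h : T -> R) (c : R) :
  uniq r -> measurable_fun setT h -> (forall w, 0 <= h w) ->
  (forall i, measurable_fun setT (z i)) ->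
  0 <= c -> 0 <= eta -> (forall i, 2 * eta * k i < 1) ->
  (forall g : I -> R, (\int[P]_w (h w * expR (\sum_(i <- r) g i * z i w))%:E <=
                  (c * expR (\sum_(i <- r) k i * g i ^+ 2 / 2))%:E)%E) ->
  (\int[P]_w (h w * expR (eta * \sum_(i <- r) z i w ^+ 2))%:E <=
    (c * \prod_(i <- r) (Num.sqrt (1 - 2 * eta * k i))^-1)%:E)%E.
Proof.
elim: r h c => [|i r IHr] h c /=.
  move=> _ mh h0 mz c0 eta0 kk /(_ (fun=> 0)); rewrite !big_nil mulr1 expR0 mulr1.
  by under eq_integral do rewrite big_nil expR0 mulr1;
     under [in X in _ -> X]eq_integral do rewrite big_nil mulr0 expR0 mulr1.
move=> /andP[ir ur] mh h0 mz c0 eta0 kk H.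
rewrite big_cons mulrA.
have -> : (\int[P]_w (h w * expR (eta * \sum_(i0 <- i :: r) z i0 w ^+ 2))%:E =
  \int[P]_w (h w * expR (eta * z i w ^+ 2) * expR (eta * \sum_(i0 <- r) z i0 w ^+ 2))%:E)%E.
  by apply: eq_integral => w _; rewrite big_cons mulrDr expRD mulrA.
apply: IHr => //.
- apply: measurable_funM => //; apply: (measurableT_comp (@measurable_expR R)).
  by apply: measurable_funM => //; exact: measurable_funX.
- by move=> w; rewrite mulr_ge0 ?expR_ge0.
- by rewrite mulr_ge0 // invr_ge0 sqrtr_ge0.
move=> g; rewrite mulrAC.
have -> : (\int[P]_w (h w * expR (eta * z i w ^+ 2) * expR (\sum_(j <- r) g j * z j w))%:E =
  \int[P]_w (h w * expR (\sum_(j <- r) g j * z j w) * expR (eta * z i w ^+ 2))%:E)%E.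
  by apply: eq_integral => w _; rewrite mulrAC.
apply: gaussian_linearization => //.
- apply: measurable_funM => //; apply: (measurableT_comp (@measurable_expR R)).
  by apply: measurable_sum => j; apply: measurable_funM.
- by move=> w; rewrite mulr_ge0 ?expR_ge0.
- by rewrite mulr_ge0 ?expR_ge0.
(* The joint hypothesis is used with coefficient x at the head; [uniq] ensures that the coefficients
   on the tail do not change. *)
move=> x; pose g' j := if j == i then x else g j.
have g'r (F : I -> R -> R) : \sum_(j <- r) F j (g' j) = \sum_(j <- r) F j (g j).
  apply: eq_big_seq => j jr; rewrite /g'; case: eqVneq => // ji.
  by rewrite ji (negbTE ir) in jr.
have g'i : g' i = x by rewrite /g' eqxx.
have := H g'; rewrite big_cons (g'r (fun j t => k j * t ^+ 2 / 2)) g'i.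
have -> : (\int[P]_w (h w * expR (\sum_(j <- i :: r) g' j * z j w))%:E =
  \int[P]_w (h w * expR (\sum_(j <- r) g j * z j w) * expR (x * z i w))%:E)%E.
  apply: eq_integral => w _; rewrite big_cons (g'r (fun j t => t * z j w)) g'i.
  by rewrite expRD mulrCA mulrC.
by move/le_trans; apply; rewrite lee_fin expRD mulrCA mulrC.
Qed.

End Linearization.

(** * Covariance matrices *)

Section Covariance.
Context d (T : measurableType d) (R : realType) (P : probability T R).

Let Pfin : P setT \is a fin_num := fin_num_measure P _ measurableT.

Lemma Lfun2_fin_num_cov (U V : T -> R) : U \in Lfun P 2%:E -> V \in Lfun P 2%:E ->
  covariance P U V \is a fin_num.
Proof.
move=> U2 V2; apply: covariance_fin_num.
- exact: Lfun_subset12.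
- exact: Lfun_subset12.
- exact: Lfun2_mul_Lfun1.
Qed.

Let Lfun2_scale (a : R) (U : T -> R) : U \in Lfun P 2%:E -> a \o* U \in Lfun P 2%:E.
Proof. by move=> U2; apply: Lfun_scale => //; rewrite ler1n. Qed.

Lemma Lfun_lincomb (I : Type) (r : seq I) (a : I -> R) (V : I -> T -> R) :
  (forall i, V i \in Lfun P 2%:E) ->
  (fun w => \sum_(i <- r) a i * V i w) \in Lfun P 2%:E.
Proof.
move=> V2; elim: r => [|i r IH].
  have -> : (fun w => \sum_(i <- [::]) a i * V i w) = cst 0.
    by apply/funext => w; rewrite big_nil.
  exact: Lfun_cst.
have -> : (fun w => \sum_(j <- i :: r) a j * V j w) =
  (a i \o* V i + (fun w => \sum_(j <- r) a j * V j w))%R.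
  by apply/funext => w; rewrite big_cons fctE /= mulrC.
rewrite rpredD //; first by rewrite lee_fin ler1n.
by move=> h; apply: Lfun_scale => //; rewrite ler1n.
Qed.

Lemma expectation_lincomb (I : Type) (r : seq I) (a : I -> R) (V : I -> T -> R) :
  (forall i, V i \in Lfun P 2%:E) ->
  fine ('E_P[(fun w => \sum_(i <- r) a i * V i w)%R])%E =
  \sum_(i <- r) a i * fine ('E_P[V i])%E.
Proof.
move=> V2.
have L1 (U : T -> R) : U \in Lfun P 2%:E -> U \in Lfun P 1 by exact: Lfun_subset12.
elim: r => [|i r IH].
  have -> : (fun w => \sum_(i <- [::]) a i * V i w) = cst 0.
    by apply/funext => w; rewrite big_nil.
  by rewrite expectation_cst big_nil.
have -> : (fun w => \sum_(j <- i :: r) a j * V j w) =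
  (a i \o* V i \+ (fun w => \sum_(j <- r) a j * V j w))%R.
  by apply/funext => w; rewrite big_cons /= mulrC.
have Vi1 := L1 _ (V2 i); have S1 := L1 _ (@Lfun_lincomb _ r a V V2).
rewrite expectationD ?Lfun_scale // big_cons -IH fineD ?expectation_fin_num ?Lfun_scale //.
by rewrite expectationZl // fineM ?expectation_fin_num.
Qed.

Lemma covariance_lincombl (I : Type) (r : seq I) (a : I -> R) (V : I -> T -> R)
    (U : T -> R) : U \in Lfun P 2%:E ->
  (forall i, V i \in Lfun P 2%:E) ->
  fine (covariance P (fun w => \sum_(i <- r) a i * V i w) U) =
  \sum_(i <- r) a i * fine (covariance P (V i) U).
Proof.
move=> U2 V2; elim: r => [|i r IH].
  have -> : (fun w => \sum_(i <- [::]) a i * V i w) = cst 0.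
    by apply/funext => w; rewrite big_nil.
  by rewrite covariance_cst_l big_nil.
have -> : (fun w => \sum_(j <- i :: r) a j * V j w) =
  (a i \o* V i \+ (fun w => \sum_(j <- r) a j * V j w))%R.
  by apply/funext => w; rewrite big_cons /= mulrC.
have S2 := @Lfun_lincomb _ r a V V2.
rewrite covarianceDl ?Lfun2_scale // big_cons -IH fineD ?Lfun2_fin_num_cov ?Lfun2_scale //.
rewrite covarianceZl ?fineM ?Lfun2_fin_num_cov //.
- exact: Lfun_subset12.
- exact: Lfun_subset12.
- exact: Lfun2_mul_Lfun1.
Qed.

Section LinearImage.
Variables (k l : nat) (L : 'M[R]_(l, k)) (V : T -> 'cV[R]_k).
Hypothesis V2 : square_integrable P V.

Let LVE i : (fun w => (L *m V w) i 0) = (fun w => \sum_j L i j * V w j 0).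
Proof. by apply/funext => w; rewrite mxE. Qed.

Lemma square_integrable_mulmx : square_integrable P (fun w => L *m V w).
Proof. by move=> i; rewrite LVE; exact: Lfun_lincomb. Qed.

Lemma mean_vec_mulmx : mean_vec P (fun w => L *m V w) = L *m mean_vec P V.
Proof.
apply/colP => i; rewrite !mxE LVE (expectation_lincomb _ _ V2).
by apply: eq_bigr => j _; rewrite mxE.
Qed.

Lemma covmx_mulmx : covmx P (fun w => L *m V w) = L *m covmx P V *m L^T.
Proof.
apply/matrixP => i j; rewrite !mxE !LVE covariance_lincombl //; last exact: Lfun_lincomb.
under eq_bigr => p _ do rewrite covarianceC covariance_lincombl // mulr_sumr.
rewrite exchange_big /=; apply: eq_bigr => q _; rewrite !mxE mulr_suml.
by apply: eq_bigr => p _; rewrite !mxE covarianceC -mulrA; congr (_ * _); rewrite mulrC.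
Qed.

End LinearImage.

Lemma square_integrable_measurable k (V : T -> 'cV[R]_k) :
  square_integrable P V -> random_vector V.
Proof. by move=> V2 i; move: (V2 i); rewrite inE => /andP[/[!inE]/= mf _]. Qed.

Lemma covmx_psd k (V : T -> 'cV[R]_k) : square_integrable P V -> psdmx (covmx P V).
Proof.
move=> V2; split; first by apply/matrixP => i j; rewrite !mxE covarianceC.
move=> v; have -> : v^T *m covmx P V *m v = covmx P (fun w => v^T *m V w).
  by rewrite covmx_mulmx // trmxK.
by rewrite mxE fine_ge0 //; exact: variance_ge0.
Qed.

Lemma covmx_posdef k (V : T -> 'cV[R]_k) : square_integrable P V ->
  covmx P V \in unitmx -> posdefmx (covmx P V).
Proof. by move=> V2; apply: psdmx_unit_posdef; exact: covmx_psd. Qed.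

Lemma expectation_norm2 k (U : T -> 'cV[R]_k) : square_integrable P U ->
  mean_vec P U = 0 ->
  ('E_P[(fun w => norm2 (U w) ^+ 2)%R] = (\tr (covmx P U))%:E)%E.
Proof.
move=> U2 U0; rewrite unlock.
have -> : (\int[P]_w (norm2 (U w) ^+ 2)%:E =
  \int[P]_w (\sum_(i < k) ((U w i 0) ^+ 2)%:E))%E.
  apply: eq_integral => w _; rewrite /norm2 sqr_sqrtr ?sumEFin //.
  by apply: sumr_ge0 => i _; exact: sqr_ge0.
have mU := square_integrable_measurable U2.
rewrite ge0_integral_sum //; last 2 first.
- by move=> i; apply/measurable_EFinP; exact: measurable_funX.
- by move=> i w _; rewrite lee_fin sqr_ge0.
rewrite /mxtrace -sumEFin; apply: eq_bigr => i _; rewrite mxE.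
have -> : covariance P (fun w => U w i 0) (fun w => U w i 0) = 'V_P[(fun w => U w i 0)].
  by [].
rewrite fineK; last exact: variance_fin_num.
rewrite varianceE //.
have -> : ('E_P[(fun w => U w i 0)%R])%E = 0%E.
  have := congr1 (fun m : 'cV_k => m i 0) U0; rewrite !mxE => /eqP.
  rewrite fine_eq0 => [/eqP //|]; apply: expectation_fin_num; exact: Lfun_subset12.
by rewrite expe2 mule0 sube0 unlock.
Qed.

End Covariance.

(** * Independent samples *)

Section WeightedDomination.
Local Open Scope ereal_scope.
Context d d' (X : measurableType d) (S : measurableType d') (R : realType)
  (mu : {measure set X -> \bar R}).

Import HBNNSimple.

Let integral_approx (r : X -> S) (phi : X -> R) (f : S -> \bar R)
    (mf : measurable_fun setT f) :
  measurable_fun setT r -> measurable_fun setT phi -> (forall x, 0 <= phi x)%R ->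
  (forall y, 0 <= f y) ->
  \int[mu]_x (f (r x) * (phi x)%:E) =
  limn (fun n => \int[mu]_x (nnsfun_approx measurableT mf n (r x) * phi x)%:E).
Proof.
move=> mr mphi phi0 f0; rewrite -monotone_convergence //.
- apply: eq_integral => x _; apply/esym/cvg_lim => //=.
  under eq_fun do rewrite EFinM.
  apply: cvgeZr => //; apply: cvg_nnsfun_approx => // y _; exact: f0.
- move=> n; apply/measurable_EFinP/measurable_funM => //.
  exact: measurableT_comp.
- by move=> n x _; rewrite lee_fin mulr_ge0.
- move=> x _ m n mn; rewrite lee_fin ler_wpM2r //; exact/lefP/nd_nnsfun_approx.
Qed.

(** An integrated form of the inequality E[phi | r] <= E[psi | r]. It extends from indicators to
    simple functions by linearity and to all nonnegative functions by monotone convergence. *)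
Lemma weighted_domination (r : X -> S) (phi psi : X -> R) :
  measurable_fun setT r ->
  measurable_fun setT phi -> measurable_fun setT psi ->
  (forall x, 0 <= phi x)%R -> (forall x, 0 <= psi x)%R ->
  (forall B, measurable B ->
    \int[mu]_x (\1_B (r x) * phi x)%:E <= \int[mu]_x (\1_B (r x) * psi x)%:E) ->
  forall f : S -> \bar R, measurable_fun setT f -> (forall y, 0 <= f y) ->
  \int[mu]_x (f (r x) * (phi x)%:E) <= \int[mu]_x (f (r x) * (psi x)%:E).
Proof.
move=> mr mphi mpsi phi0 psi0 H f mf f0.
have simple (h : {nnsfun S >-> R}) :
    \int[mu]_x (h (r x) * phi x)%:E <= \int[mu]_x (h (r x) * psi x)%:E.
  have decomp (g : X -> R) : measurable_fun setT g -> (forall x, 0 <= g x)%R ->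
      \int[mu]_x (h (r x) * g x)%:E =
      \sum_(k \in range h) (k%:E * \int[mu]_x (\1_(h @^-1` [set k]) (r x) * g x)%:E).
    move=> mg g0.
    have mk k : measurable_fun setT
        (fun x : X => (\1_(h @^-1` [set k]) (r x) * g x)%R).
      by apply: measurable_funM => //; apply: (measurableT_comp _ mr).
    transitivity (\int[mu]_x (\sum_(k \in range h)
        (k * (\1_(h @^-1` [set k]) (r x) * g x))%:E)).
      apply: eq_integral => x _; rewrite fimfunE fsumEFin //; congr (_%:E).
      by rewrite mulr_fsuml //; apply: eq_fsbigr => k _; rewrite mulrA.
    rewrite ge0_integral_fsum //.
    - apply: eq_fsbigr => k /set_mem [y _ <-].
      under eq_integral do rewrite EFinM.
      rewrite ge0_integralZl_EFin //.
      + by move=> x _; rewrite lee_fin mulr_ge0.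
      + exact/measurable_EFinP.
    - by move=> k; apply/measurable_EFinP; apply: measurable_funM.
    - move=> k x _; rewrite mulrA EFinM mule_ge0 ?lee_fin //.
      by have := nnfun_muleindic_ge0 h k (r x); rewrite -EFinM lee_fin.
  rewrite !decomp //; apply: lee_fsum => // k [y _ <-].
  by apply: lee_wpmul2l; [rewrite lee_fin|exact: H].
rewrite !(integral_approx mf) //; apply: lee_lim.
- apply/ereal_nondecreasing_is_cvgn => m n mn; apply: ge0_le_integral => //.
  + by move=> x _; rewrite lee_fin mulr_ge0.
  + by apply/measurable_EFinP/measurable_funM => //; exact: measurableT_comp.
  + by apply/measurable_EFinP/measurable_funM => //; exact: measurableT_comp.
  + by move=> x _; rewrite lee_fin ler_wpM2r //; exact/lefP/nd_nnsfun_approx.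
- apply/ereal_nondecreasing_is_cvgn => m n mn; apply: ge0_le_integral => //.
  + by move=> x _; rewrite lee_fin mulr_ge0.
  + by apply/measurable_EFinP/measurable_funM => //; exact: measurableT_comp.
  + by apply/measurable_EFinP/measurable_funM => //; exact: measurableT_comp.
  + by move=> x _; rewrite lee_fin ler_wpM2r //; exact/lefP/nd_nnsfun_approx.
- by apply: nearW => n; exact: simple.
Qed.

End WeightedDomination.

(** * Joint law of an independent pair *)

Section Laws.
Local Open Scope ereal_scope.
Context d (T : measurableType d) d1 (S1 : measurableType d1)
  d2 (S2 : measurableType d2) (R : realType) (Q : probability T R).

Lemma integral_indep_pair (U : {mfun T >-> S1}) (V : {mfun T >-> S2}) :
  (forall A B, measurable A -> measurable B ->
    Q (U @^-1` A `&` V @^-1` B) = Q (U @^-1` A) * Q (V @^-1` B)) ->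
  forall f : S1 * S2 -> \bar R, measurable_fun setT f -> (forall z, 0 <= f z) ->
  \int[Q]_w f (U w, V w) =
  \int[distribution Q U]_u \int[distribution Q V]_v f (u, v).
Proof.
move=> indep f mf f0.
have mUV : measurable_fun setT (fun w => (U w, V w)) by exact: measurable_fun_pair.
have -> : \int[Q]_w f (U w, V w) =
    \int[pushforward Q (fun w => (U w, V w))]_z f z.
  by rewrite ge0_integral_pushforward.
rewrite -(@fubini_tonelli1 _ _ _ _ R (distribution Q U) (distribution Q V) f) //.
apply: eq_measure_integral => /= A mA _; apply/esym.
apply: (@product_measure_unique _ _ _ _ R (distribution Q U) (distribution Q V)
  (pushforward Q (fun w => (U w, V w)))) => //.
Qed.

End Laws.

(* Supplies the measurability proof that the canonical measure structure of
   pushforward leaves to unification. *)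
Definition image_measure d d' (T : measurableType d) (S : measurableType d')
    (R : realType) (m : {measure set T -> \bar R}) (f : T -> S)
    (mf : measurable_fun setT f) : {measure set S -> \bar R} :=
  measure_function_pushforward__canonical__measure_function_Measure m mf.

(** * The product sigma-algebra on tuples and independent families *)

Section TupleSamples.
Context d (T : measurableType d) d' (S : measurableType d') (R : realType)
  (Q : probability T R).

Definition box n (C : 'I_n -> set S) : set (n.-tuple S) :=
  [set t | forall i, C i (tnth t i)].

Definition boxes n : set (set (n.-tuple S)) :=
  [set B | exists2 C : 'I_n -> set S, (forall i, measurable (C i)) & B = box C].

Lemma measurable_box n (C : 'I_n -> set S) :
  (forall i, measurable (C i)) -> measurable (box C).
Proof.
move=> mC; have -> : box C = \bigcap_(i in [set: 'I_n]) ((@tnth _ _ ^~ i) @^-1` C i).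
  by apply/seteqP; split => t /= h i; [move=> _|]; apply: h.
apply: fin_bigcap_measurable => // i _.
rewrite -[X in measurable X]setTI; exact: measurable_tnth.
Qed.

(** Boxes are closed under intersection and each coordinate cylinder is a box, so two finite
    measures that agree on boxes agree everywhere. *)
Lemma measurable_boxes n : @measurable _ (n.-tuple S) = <<s @boxes n >>.
Proof.
apply/seteqP; split; last first.
  apply: smallest_sub; first exact: sigma_algebra_measurable.
  by move=> _ [C mC ->]; exact: measurable_box.
apply: smallest_sub; first exact: smallest_sigma_algebra.
case: n => [|n]; first by rewrite big_ord0.
rewrite -bigcup_mkord_ord; apply: bigcup_sub => k kn A [B mB <-].
apply: sub_sigma_algebra; exists (fun i => if i == inord k then B else setT).
  by move=> i; case: ifP.
rewrite setTI; apply/seteqP; split => t /= h.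
  by move=> i; case: eqVneq => // ->.
by have := h (inord k); rewrite eqxx.
Qed.

Lemma setI_closed_boxes n : setI_closed (@boxes n).
Proof.
move=> _ _ [C mC ->] [D mD ->]; exists (fun i => C i `&` D i).
  by move=> i; exact: measurableI.
by apply/seteqP; split => t /=; [move=> [h1 h2] i; split|move=> h; split => i; have [] := h i].
Qed.

Lemma boxesT n : @boxes n setT.
Proof. by exists (fun=> setT) => //; apply/seteqP; split. Qed.

Definition indep_maps n (s : 'I_n -> T -> S) :=
  forall B : 'I_n -> set S, (forall i, measurable (B i)) ->
  Q (\bigcap_i (s i @^-1` B i)) = (\prod_(i < n) fine (Q (s i @^-1` B i)))%:E.

Definition tmap n (s : 'I_n -> T -> S) (w : T) : n.-tuple S := [tuple s i w | i < n].

Lemma measurable_tmap n (s : 'I_n -> T -> S) :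
  (forall i, measurable_fun setT (s i)) -> measurable_fun setT (tmap s).
Proof.
move=> ms; apply/measurable_fun_tnthP => i.
by have -> : (@tnth _ _ ^~ i \o tmap s) = s i by apply/funext => w /=; rewrite tnth_mktuple.
Qed.

Lemma tmap_cons n (s : 'I_n.+1 -> T -> S) w :
  tmap s w = [tuple of s ord0 w :: tmap (fun i => s (lift ord0 i)) w].
Proof.
apply: eq_from_tnth => i; rewrite tnth_mktuple.
case: (unliftP ord0 i) => [j|] ->; last by rewrite tnth0.
by rewrite tnthS tnth_mktuple.
Qed.

Lemma bigcap_ord_recl n (F : 'I_n.+1 -> set T) :
  \bigcap_i F i = F ord0 `&` \bigcap_i F (lift ord0 i).
Proof.
apply/seteqP; split => w /= h.
  by split; [exact: h|move=> i _; exact: h].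
move=> i _; case: (unliftP ord0 i) => [j|] ->; first exact: h.2.
exact: h.1.
Qed.

Lemma indep_maps_tail n (s : 'I_n.+1 -> T -> S) :
  indep_maps s -> indep_maps (fun i => s (lift ord0 i)).
Proof.
move=> Hs B mB.
pose B' i := if unlift ord0 i is Some j then B j else setT.
have mB' i : measurable (B' i) by rewrite /B'; case: unlift.
have := Hs B' mB'; rewrite bigcap_ord_recl big_ord_recl /B' unlift_none preimage_setT setTI.
rewrite probability_setT /= mul1r.
under eq_bigcapr do rewrite liftK.
by under eq_bigr do rewrite liftK.
Qed.

(** For fixed A both sides are finite measures in B. On boxes they agree by the product rule, and
    boxes form a generating pi-system. *)
Lemma indep_head_tail n (s : 'I_n.+1 -> T -> S) :
  (forall i, measurable_fun setT (s i)) -> indep_maps s ->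
  forall A B, measurable A -> measurable B ->
  Q (s ord0 @^-1` A `&` tmap (fun i => s (lift ord0 i)) @^-1` B) =
  (Q (s ord0 @^-1` A) * Q (tmap (fun i => s (lift ord0 i)) @^-1` B))%E.
Proof.
move=> ms Hs A B mA mB; set s' := fun i => s (lift ord0 i).
have ms' : measurable_fun setT (tmap s') by apply: measurable_tmap => i; exact: ms.
have mD : measurable (s ord0 @^-1` A).
  by rewrite -[X in measurable X]setTI; exact: ms.
have QD : Q (s ord0 @^-1` A) \is a fin_num by exact: fin_num_measure.
have q0 : (0 <= fine (Q (s ord0 @^-1` A)))%R by exact/fine_ge0/measure_ge0.
(* The image of Q restricted to the head event, to be compared with the image of Q scaled by the
   probability of that event. *)
pose m1 := image_measure (mrestr Q mD) ms'.
pose m2 := mscale (NngNum q0) (image_measure Q ms').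
have -> : Q (s ord0 @^-1` A `&` tmap s' @^-1` B) = m1 B.
  by rewrite /m1 /image_measure /= /pushforward /mrestr setIC.
have -> : (Q (s ord0 @^-1` A) * Q (tmap s' @^-1` B))%E = m2 B.
  by rewrite /m2 /mscale /= /pushforward fineK.
have preb (C : 'I_n -> set S) : tmap s' @^-1` box C = \bigcap_i (s' i @^-1` C i).
  apply/seteqP; split => w /= h i; first by move=> _; have := h i; rewrite tnth_mktuple.
  by rewrite tnth_mktuple; exact: h.
apply: (@measure_unique _ R _ (@boxes n) (fun=> setT) (@measurable_boxes n)
  (@setI_closed_boxes n) (fun=> @boxesT n) _ m1 m2) => //.
- by apply/seteqP; split => // t _; exists 0.
- move=> _ [C mC ->]; rewrite /m1 /m2 /mscale /= /pushforward /mrestr preb.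
  have mC' i : measurable (if unlift ord0 i is Some j then C j else A).
    by case: unlift.
  have := Hs _ mC'; rewrite bigcap_ord_recl big_ord_recl unlift_none.
  under eq_bigcapr do rewrite liftK.
  under eq_bigr do rewrite liftK.
  rewrite setIC => ->; rewrite EFinM; congr (_ * _)%E.
  by rewrite -(indep_maps_tail Hs mC) -preb.
- by move=> _; rewrite /m1 /image_measure /= /pushforward /mrestr preimage_setT setTI ltey_eq QD.
Qed.

End TupleSamples.

(** * Domination of product weights for independent samples *)

Section SampleDomination.
Context d (T : measurableType d) d' (S : measurableType d')
  d'' (S' : measurableType d'') (R : realType) (Q : probability T R).
Local Open Scope ereal_scope.

Let mpack dX dY (X : measurableType dX) (Y : measurableType dY) (f : X -> Y)
  (mf : measurable_fun setT f) : {mfun X >-> Y} :=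
  HB.pack f (isMeasurableFun.Build _ _ _ _ f mf).

Lemma measurable_map_tuple n (r : S -> S') : measurable_fun setT r ->
  measurable_fun [set: n.-tuple S] (map_tuple r : n.-tuple S -> n.-tuple S').
Proof.
move=> mr; apply/measurable_fun_tnthP => i.
have -> : (@tnth _ _ ^~ i \o map_tuple r) = r \o (@tnth n S ^~ i).
  by apply/funext => t /=; rewrite tnth_map.
apply: measurableT_comp => //; exact: measurable_tnth.
Qed.

(* The weights are integrated out one sample at a time, by Fubini. *)
Lemma indep_domination n (s : 'I_n -> T -> S) (r : S -> S') (phi : 'I_n -> S -> R) :
  (forall i, measurable_fun setT (s i)) -> indep_maps Q s ->
  measurable_fun setT r ->
  (forall i, measurable_fun setT (phi i)) -> (forall i x, 0 <= phi i x)%R ->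
  (forall i B, measurable B ->
    \int[Q]_w (\1_B (r (s i w)) * phi i (s i w))%:E <= Q ((r \o s i) @^-1` B)) ->
  forall f : n.-tuple S' -> \bar R, measurable_fun setT f -> (forall t, 0 <= f t) ->
  \int[Q]_w (f (map_tuple r (tmap s w)) * (\prod_(i < n) phi i (s i w))%:E) <=
  \int[Q]_w f (map_tuple r (tmap s w)).
Proof.
move=> ms Hs mr mphi phi0; elim: n s phi ms Hs mphi phi0 => [|n IHn] s phi ms Hs mphi phi0 H f mf f0.
  by under eq_integral do rewrite big_ord0 mule1.
pose s' i := s (lift ord0 i).
have ms' i : measurable_fun setT (s' i) by exact: ms.
have mU := measurable_tmap ms'.
pose U : {mfun T >-> n.-tuple S} := mpack mU.
pose V : {mfun T >-> S} := mpack (ms ord0).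
have indep A B : measurable A -> measurable B ->
    Q (U @^-1` A `&` V @^-1` B) = Q (U @^-1` A) * Q (V @^-1` B).
  by move=> mA mB; rewrite setIC muleC; exact: (indep_head_tail ms Hs mB mA).
pose psi (u : n.-tuple S) : R := (\prod_(i < n) phi (lift ord0 i) (tnth u i))%R.
have mpsi : measurable_fun setT psi.
  apply: measurable_prod => i _; apply: measurableT_comp => //; exact: measurable_tnth.
have psi0 u : (0 <= psi u)%R by apply: prodr_ge0.
pose c (z : n.-tuple S * S) : n.+1.-tuple S' :=
  [the n.+1.-tuple S' of r z.2 :: map_tuple r z.1].
have mc : measurable_fun setT c.
  apply: measurable_cons.
    apply: measurableT_comp => //; exact: measurable_snd.
  apply: measurableT_comp; first exact: measurable_map_tuple.
  exact: measurable_fst.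
have cE w : map_tuple r (tmap s w) = c (U w, V w).
  by rewrite tmap_cons; apply/val_inj.
pose f1 (z : n.-tuple S * S) : \bar R := f (c z) * (phi ord0 z.2 * psi z.1)%:E.
have mf1 : measurable_fun setT f1.
  apply: emeasurable_funM; first exact: measurableT_comp.
  apply/measurable_EFinP/measurable_funM.
    apply: measurableT_comp => //; exact: measurable_snd.
  apply: measurableT_comp => //; exact: measurable_fst.
have f10 z : 0 <= f1 z by rewrite mule_ge0 ?lee_fin ?mulr_ge0.
have -> : \int[Q]_w (f (map_tuple r (tmap s w)) * (\prod_(i < n.+1) phi i (s i w))%:E) =
    \int[Q]_w f1 (U w, V w).
  apply: eq_integral => w _; rewrite cE big_ord_recl /f1 /=; congr (_ * (_ * _)%:E).
  by apply: eq_bigr => i _; rewrite tnth_mktuple.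
rewrite (integral_indep_pair indep mf1 f10).
(* The intermediate integrand, with the weight of the head sample removed. For each fixed tail this
   removal is [weighted_domination] under the law of the head. *)
pose f2 (z : n.-tuple S * S) : \bar R := f (c z) * (psi z.1)%:E.
have mf2 : measurable_fun setT f2.
  apply: emeasurable_funM; first exact: measurableT_comp.
  apply/measurable_EFinP; apply: measurableT_comp => //; exact: measurable_fst.
have f20 z : 0 <= f2 z by rewrite mule_ge0 ?lee_fin.
apply: (@le_trans _ _ (\int[Q]_w f2 (U w, V w))).
  rewrite (integral_indep_pair indep mf2 f20); apply: ge0_le_integral => //.
  - by move=> u _; apply: integral_ge0.
  - exact: (measurable_fun_fubini_tonelli_F f1).
  - exact: (measurable_fun_fubini_tonelli_F f2).
  move=> u _.
  rewrite /f1 /f2 /=.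
  pose g (y : S') : \bar R := f [the n.+1.-tuple S' of y :: map_tuple r u] * (psi u)%:E.
  have mg : measurable_fun setT g.
    apply: emeasurable_funM => //; apply: measurableT_comp => //.
    by apply: measurable_cons => //.
  have g0 y : 0 <= g y by rewrite mule_ge0 ?lee_fin.
  have := @weighted_domination _ _ _ _ R (distribution Q V) r (phi ord0) (cst 1%R)
    mr (mphi ord0) (measurable_cst _) (phi0 ord0) (fun=> ler01) _ g mg g0.
  have e1 : \int[distribution Q V]_v (f (c (u, v)) * (phi ord0 v * psi u)%:E) =
      \int[distribution Q V]_x (g (r x) * (phi ord0 x)%:E).
    by apply: eq_integral => v _; rewrite /g /c /= -muleA -EFinM mulrC.
  have e2 : \int[distribution Q V]_v (f (c (u, v)) * (psi u)%:E) =
      \int[distribution Q V]_x (g (r x) * 1%:E).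
    by apply: eq_integral => v _; rewrite /g /c /= mule1.
  rewrite e1 e2; apply => B mB.
  rewrite !ge0_integral_distribution //; last 4 first.
  - apply/measurable_EFinP/measurable_funM => //.
    by apply: measurableT_comp.
  - by move=> y; rewrite lee_fin mulr_ge0.
  - apply/measurable_EFinP/measurable_funM => //.
    by apply: measurableT_comp.
  - by move=> y; rewrite lee_fin mulr_ge0.
  apply: le_trans (H ord0 B mB) _.
  have mBs : measurable ((r \o s ord0) @^-1` B).
    by rewrite -[X in measurable X]setTI; apply: (measurableT_comp mr (ms ord0)).
  under [leRHS]eq_integral do rewrite /= mulr1.
  by rewrite (integral_indic _ measurableT (mBs)) setIT.
(* Integrating the head out of f leaves a function of the tail alone, to which the induction
   hypothesis applies. *)
pose g (t : n.-tuple S') : \bar R :=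
  \int[distribution Q V]_v f [the n.+1.-tuple S' of r v :: t].
pose k (z : n.-tuple S' * S) : \bar R := f [the n.+1.-tuple S' of r z.2 :: z.1].
have mk : measurable_fun setT k.
  apply: measurableT_comp => //; apply: measurable_cons => //.
  apply: measurableT_comp => //; exact: measurable_snd.
have mg : measurable_fun setT g.
  apply: (@measurable_fun_fubini_tonelli_F _ _ _ _ R (distribution Q V) k mk).
  by move=> z; exact: f0.
have g0 t : 0 <= g t by apply: integral_ge0.
rewrite (integral_indep_pair indep mf2 f20).
have mfc : measurable_fun setT (f \o c) by exact: measurableT_comp.
have -> : \int[Q]_w f (map_tuple r (tmap s w)) = \int[Q]_w (f \o c) (U w, V w).
  by apply: eq_integral => w _; rewrite cE.
have fc0 z : 0 <= (f \o c) z by exact: f0.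
rewrite (integral_indep_pair indep mfc fc0).
have -> : \int[distribution Q U]_u \int[distribution Q V]_v f2 (u, v) =
    \int[distribution Q U]_u (g (map_tuple r u) * (psi u)%:E).
  apply: eq_integral => u _; rewrite /g -ge0_integralZr //.
  - apply: measurableT_comp => //; apply: measurable_cons => //.
  - by rewrite lee_fin.
have mgr : measurable_fun setT (fun u : n.-tuple S => g (map_tuple r u)).
  by apply: measurableT_comp => //; exact: measurable_map_tuple.
rewrite ge0_integral_distribution //; last 2 first.
- by apply: emeasurable_funM => //; exact/measurable_EFinP.
- by move=> u; rewrite mule_ge0 ?lee_fin.
rewrite [leRHS](ge0_integral_distribution _ mgr) //.
have := IHn s' (fun i => phi (lift ord0 i)) ms' (indep_maps_tail Hs) (fun i => mphi _)
  (fun i => phi0 _) (fun i => H _) g mg g0.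
congr (_ <= _); apply: eq_integral => w _ /=; congr (_ * _%:E).
by apply: eq_bigr => i _; rewrite tnth_mktuple.
Qed.

End SampleDomination.

(** * Parameters depending on the data *)

Section Grid.
Variable R : realType.

(** Rounding down to the lattice of mesh 1/(k+1): countably many values, with error at most
    [harmonic k]. *)
Definition grid (k : nat) (x : R) : R := (Num.floor (k.+1%:R * x))%:~R / k.+1%:R.

Lemma grid_le k x : grid k x <= x.
Proof. by rewrite /grid ler_pdivrMr ?ltr0n // mulrC floor_le. Qed.

Lemma grid_ge k x : x - harmonic k <= grid k x.
Proof.
rewrite /grid /harmonic ler_pdivlMr ?ltr0n // mulrBl mulVf ?pnatr_eq0 // lerBlDr.
by rewrite mulrC -(intrD _ _ 1) ltW // floorD1_gt.
Qed.

Lemma grid_cvg x : grid k x @[k --> \oo] --> x.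
Proof.
apply: (@squeeze_cvgr _ _ _ _ (fun k => x - harmonic k) (cst x)).
- by apply: nearW => k; rewrite grid_ge grid_le.
- rewrite -[X in _ --> X]subr0; apply: cvgB; [exact: cvg_cst|exact: cvg_harmonic].
- exact: cvg_cst.
Qed.

End Grid.

Section Freezing.
Context d (T : measurableType d) d' (S : measurableType d') (R : realType)
  (Q : probability T R) (p q : nat).
Local Open Scope ereal_scope.

(* A bound that holds for each constant parameter a also holds for a parameter
   depending measurably on y: round it to a countably valued one, split along
   its values, and pass to the limit with Fatou's lemma. *)
Lemma freezing (y : T -> S) (L : 'M[R]_(p, q) -> T -> R) (alpha : S -> 'M[R]_(p, q)) :
  measurable_fun setT y ->
  (forall a w, 0 <= L a w)%R ->
  (forall a : S -> 'M[R]_(p, q), (forall i j, measurable_fun setT (fun s => a s i j)) ->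
    measurable_fun setT (fun w => L (a (y w)) w)) ->
  (forall (a_ : nat -> 'M[R]_(p, q)) (a : 'M[R]_(p, q)) w,
    (forall i j, (fun k => a_ k i j) @ \oo --> a i j) ->
    (fun k => L (a_ k) w) @ \oo --> L a w) ->
  (forall a B, measurable B ->
    \int[Q]_w (\1_B (y w) * L a w)%:E <= Q (y @^-1` B)) ->
  (forall i j, measurable_fun setT (fun s => alpha s i j)) ->
  forall B, measurable B ->
  \int[Q]_w (\1_B (y w) * L (alpha (y w)) w)%:E <= Q (y @^-1` B).
Proof.
move=> my L0 mL cL H malpha B mB.
have my' C : measurable C -> measurable (y @^-1` C).
  by move=> mC; rewrite -[X in measurable X]setTI; exact: my.
have m1y C : measurable C -> measurable_fun setT (fun w => \1_C (y w) : R).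
  by move=> mC; apply: (measurableT_comp (measurable_indic mC)).
pose fl k (s : S) : 'M[int]_(p, q) := \matrix_(i, j) Num.floor (k.+1%:R * alpha s i j)%R.
pose al k (s : S) : 'M[R]_(p, q) := \matrix_(i, j) grid k (alpha s i j).
have alE k s s' : fl k s = fl k s' -> al k s = al k s'.
  move=> e; apply/matrixP => i j; rewrite !mxE /grid.
  by have := congr1 (fun m : 'M[int]_(p, q) => m i j) e; rewrite !mxE => ->.
(* [pickle] numbers the integer matrices, so that the fibres of the rounding form a sequence, as
   countable additivity requires. *)
pose F k (m : nat) : set S := [set s | pickle (fl k s) = m].
have mfl k i j z : measurable [set s | fl k s i j = z].
  have -> : [set s | fl k s i j = z] =
     (fun s => alpha s i j) @^-1` [set x : R | (z%:~R / k.+1%:R <= x)%R] `&`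
     (fun s => alpha s i j) @^-1` [set x : R | (x < (z + 1)%:~R / k.+1%:R)%R].
    apply/seteqP; split => s /=; rewrite mxE ler_pdivrMr ?ltr0n // ltr_pdivlMr ?ltr0n // mulrC.
      by move=> /eqP; rewrite floor_eq => /andP.
    by move=> h; apply/eqP; rewrite floor_eq; apply/andP.
  apply: measurableI; rewrite -[X in measurable X]setTI; apply: malpha => //.
    have -> : [set x : R | (z%:~R / k.+1%:R <= x)%R] = `[(z%:~R / k.+1%:R)%R, +oo[%classic.
      by apply/seteqP; split => x /=; rewrite in_itv /= andbT.
    exact: measurable_itv.
  have -> : [set x : R | (x < (z + 1)%:~R / k.+1%:R)%R] = `]-oo, ((z + 1)%:~R / k.+1%:R)%R[%classic.
    by apply/seteqP; split => x /=; rewrite in_itv.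
  exact: measurable_itv.
have mF k m : measurable (F k m).
  have [[s0 s0m]|nos] := pselect (exists s, F k m s); last first.
    by rewrite (_ : F k m = set0) //; apply/seteqP; split => // s Fs; case: nos; exists s.
  have -> : F k m = \bigcap_(ij in [set: 'I_p * 'I_q])
      [set s | fl k s ij.1 ij.2 = fl k s0 ij.1 ij.2].
    apply/seteqP; split => s /=.
      by rewrite -s0m /F /= => /(pcan_inj pickleK) e ij _ /=; rewrite e.
    move=> h; rewrite /F /= -s0m; congr pickle; apply/matrixP => i j.
    exact: (h (i, j) Logic.I).
  by apply: fin_bigcap_measurable.
have mgrid k i j : measurable_fun setT (fun s => al k s i j).
  have -> : (fun s => al k s i j) = (fun s => (fl k s i j)%:~R / k.+1%:R)%R.
    by apply/funext => s; rewrite !mxE.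
  apply: measurable_funM => //.
  move=> _ C mC; rewrite setTI.
  have -> : (fun s => (fl k s i j)%:~R : R) @^-1` C =
      \bigcup_(z : int) [set s | C z%:~R /\ fl k s i j = z].
    apply/seteqP; split => s /=; first by move=> h; exists (fl k s i j).
    by move=> [z _ /= [Cz ->]].
  apply: countable_bigcupT_measurable => // z.
  have [Cz|nCz] := pselect (C z%:~R); last first.
    by rewrite (_ : [set s | _] = set0) //; apply/seteqP; split => // s [].
  rewrite (_ : [set s | _] = [set s | fl k s i j = z]) //.
  by apply/seteqP; split => s /=; [case|].
have mLk k : measurable_fun setT (fun w => \1_B (y w) * L (al k (y w)) w)%R.
  by apply: measurable_funM; [exact: m1y|exact: mL].
have step k : \int[Q]_w (\1_B (y w) * L (al k (y w)) w)%:E <= Q (y @^-1` B).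
  pose G m := y @^-1` F k m.
  have mG m : measurable (G m) by exact: my'.
  have GT : \bigcup_m G m = setT.
    by apply/seteqP; split => // w _; exists (pickle (fl k (y w))).
  have tG : trivIset setT G.
    apply/trivIsetP => m m' _ _ mm'; apply/seteqP; split => // w [e1 e2].
    by move: mm'; rewrite -e1 -e2 eqxx.
  have split_int (f : T -> \bar R) : measurable_fun setT f -> (forall w, 0 <= f w) ->
      \int[Q]_w f w = \sum_(0 <= m <oo) \int[Q]_(w in G m) f w.
    move=> mf f0; rewrite -[in LHS]GT ge0_integral_bigcup //.
    by rewrite GT.
  have -> : Q (y @^-1` B) = \int[Q]_w (\1_B (y w))%:E.
    by rewrite (integral_indic _ measurableT (my' _ mB)) setIT.
  rewrite !split_int //; last 3 first.
  - by apply/measurable_EFinP; exact: m1y.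
  - exact/measurable_EFinP.
  - by move=> w; rewrite lee_fin mulr_ge0.
  apply: lee_nneseries => m _; first by move=> _; apply: integral_ge0 => w _; rewrite lee_fin mulr_ge0.
  have [[s0 s0m]|nos] := pselect (exists s, F k m s); last first.
    have -> : G m = set0 by apply/seteqP; split => // w Gw; case: nos; exists (y w).
    by rewrite !integral_set0.
  (* On one fibre the rounded parameter is the constant [al k s0], so the hypothesis applies to it
     with B cut down to the fibre. *)
  have -> : \int[Q]_(w in G m) (\1_B (y w) * L (al k (y w)) w)%:E =
      \int[Q]_w (\1_(B `&` F k m) (y w) * L (al k s0) w)%:E.
    rewrite integral_mkcond; apply: eq_integral => w _; rewrite patchE indicI /=.
    rewrite [X in (_ * X * _)%:E]indicE.
    have -> : (w \in G m) = (y w \in F k m) by apply/idP/idP; rewrite !inE.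
    case: ifPn => [|_]; last by rewrite mulr0 mul0r.
    rewrite inE => Fw; rewrite mulr1 (alE k _ s0) //.
    by apply: (pcan_inj pickleK); rewrite Fw s0m.
  apply: le_trans (H _ _ (measurableI _ _ mB (mF k m))) _.
  by rewrite (integral_indic _ (mG m) (my' _ mB)) preimage_setI.
(* By continuity of L in its parameter the integrand is the limit of the rounded ones; writing it as
   a lower limit prepares for Fatou. *)
have -> : \int[Q]_w (\1_B (y w) * L (alpha (y w)) w)%:E =
    \int[Q]_w limn_einf (fun k => (\1_B (y w) * L (al k (y w)) w)%:E).
  apply: eq_integral => w _; apply/esym.
  have cw : ((\1_B (y w) * L (al k (y w)) w)%:E @[k --> \oo]) -->
      (\1_B (y w) * L (alpha (y w)) w)%:E.
    apply: cvg_EFin; first by apply: nearW.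
    apply: cvgM; first exact: cvg_cst.
    by apply: cL => i j; under eq_fun do rewrite mxE; exact: grid_cvg.
  rewrite is_cvg_limn_einfE; last by apply/cvg_ex; eexists; exact: cw.
  exact/cvg_lim.
apply: le_trans (fatou _ _ _ _) _ => //.
- by move=> k; exact/measurable_EFinP.
- by move=> k w _; rewrite lee_fin mulr_ge0.
rewrite limn_einf_lim; apply: lime_le; first exact: is_cvg_einfs.
apply: nearW => k; apply: le_trans (step k).
by apply: ereal_inf_lbound; exists k => /=.
Qed.

End Freezing.

(** * Laws and conditional expectations *)

Section CoordinateTuple.
Variable R : realType.

(** Tuples carry the product sigma-algebra as a measurable type. Through [ctup], [sigma_of V]
    consists of the preimages of measurable sets of tuples, and the results on tuples apply to
    vectors. *)
Definition ctup {k} (v : 'cV[R]_k) : k.-tuple R := [tuple v i 0 | i < k].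

Lemma sigma_ofP (T : Type) k (V : T -> 'cV[R]_k) A :
  sigma_of V A <-> exists2 B, measurable B & A = (ctup \o V) @^-1` B.
Proof.
rewrite /sigma_of.
have -> : (fun (i : 'I_k) (w : T) => V w i 0) =
    (fun i => (fun t : k.-tuple R => tnth t i) \o (ctup \o V)).
  by apply/funext => i; apply/funext => w /=; rewrite tnth_mktuple.
rewrite g_sigma_preimage_comp; split.
  by move=> [B mB <-]; exists B => //; rewrite setTI.
by move=> [B mB ->]; exists B => //; rewrite setTI.
Qed.

Context d (T : measurableType d).

Lemma measurable_ctup k (V : T -> 'cV[R]_k) : random_vector V ->
  measurable_fun setT (ctup \o V).
Proof.
move=> mV; apply/measurable_fun_tnthP => i.
have -> : (@tnth _ _ ^~ i \o (ctup \o V)) = (fun w => V w i 0).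
  by apply/funext => w /=; rewrite tnth_mktuple.
exact: mV.
Qed.

Lemma sigma_of_measurable k (V : T -> 'cV[R]_k) A : random_vector V ->
  sigma_of V A -> measurable A.
Proof.
move=> mV /sigma_ofP[B mB ->]; rewrite -[X in measurable X]setTI.
exact: (measurable_ctup mV).
Qed.

Lemma random_vector_mulmx k l (L : 'M[R]_(l, k)) (V : T -> 'cV[R]_k) :
  random_vector V -> random_vector (fun w => L *m V w).
Proof.
move=> mV i.
have -> : (fun w => (L *m V w) i 0) = (fun w => \sum_j L i j * V w j 0).
  by apply/funext => w; rewrite mxE.
by apply: measurable_sum => j; apply: measurable_funM.
Qed.

Lemma random_vector_col_mx k l (U : T -> 'cV[R]_k) (V : T -> 'cV[R]_l) :
  random_vector U -> random_vector V -> random_vector (fun w => col_mx (U w) (V w)).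
Proof.
move=> mU mV i; case: (split_ordP i) => j ->.
  have -> : (fun w => col_mx (U w) (V w) (lshift l j) 0) = (fun w => U w j 0).
    by apply/funext => w; rewrite col_mxEu.
  exact: mU.
have -> : (fun w => col_mx (U w) (V w) (rshift k j) 0) = (fun w => V w j 0).
  by apply/funext => w; rewrite col_mxEd.
exact: mV.
Qed.

Lemma independent_family_indep_maps (Q : probability T R) n k
    (V : 'I_n -> T -> 'cV[R]_k) :
  independent_family Q V -> indep_maps Q (fun i => ctup \o V i).
Proof. by move=> h B mB; apply: h => i; apply/sigma_ofP; exists (B i). Qed.

End CoordinateTuple.
Arguments ctup {R k} v.

(** * Transfer of integrals and moments between variables of equal law *)

Section SameLaw.
Context d (T : measurableType d) d' (Omega : measurableType d')
  dS (S : measurableType dS) (R : realType)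
  (Q : probability Omega R) (P : probability T R).
Variables (u : Omega -> S) (v : T -> S).
Hypothesis mu_ : measurable_fun setT u.
Hypothesis mv_ : measurable_fun setT v.
Hypothesis law : forall B, measurable B -> Q (u @^-1` B) = P (v @^-1` B).

Let ge0_law (f : S -> \bar R) : measurable_fun setT f -> (forall s, 0 <= f s)%E ->
  (\int[Q]_w f (u w) = \int[P]_w f (v w))%E.
Proof.
move=> mf f0.
transitivity (\int[image_measure Q mu_]_s f s)%E.
  by rewrite ge0_integral_pushforward.
transitivity (\int[image_measure P mv_]_s f s)%E; last first.
  by rewrite ge0_integral_pushforward.
by apply: eq_measure_integral => A mA _; rewrite /image_measure /= /pushforward law.
Qed.

Lemma law_integral (f : S -> \bar R) : measurable_fun setT f ->
  (\int[Q]_w f (u w) = \int[P]_w f (v w))%E.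
Proof.
move=> mf; rewrite integralE [RHS]integralE; congr (_ - _)%E.
- transitivity (\int[Q]_w (f^\+ (u w)))%E.
    by apply: eq_integral => w _; rewrite !funeposE.
  rewrite (ge0_law (measurable_funepos mf) (funepos_ge0 f)).
  by apply: eq_integral => w _; rewrite !funeposE.
- transitivity (\int[Q]_w (f^\- (u w)))%E.
    by apply: eq_integral => w _; rewrite !funenegE.
  rewrite (ge0_law (measurable_funeneg mf) (funeneg_ge0 f)).
  by apply: eq_integral => w _; rewrite !funenegE.
Qed.

Lemma law_expectation (f : S -> R) : measurable_fun setT f ->
  ('E_Q[(fun w => f (u w))%R] = 'E_P[(fun w => f (v w))%R])%E.
Proof.
by move=> mf; rewrite unlock; apply: (@law_integral (EFin \o f)); exact/measurable_EFinP.
Qed.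

Lemma law_integrable (f : S -> R) : measurable_fun setT f ->
  P.-integrable setT (EFin \o (f \o v)) -> Q.-integrable setT (EFin \o (f \o u)).
Proof.
move=> mf /integrableP[_ fin]; apply/integrableP; split.
  by apply/measurable_EFinP; exact: measurableT_comp.
rewrite (@law_integral (fun s => `|(f s)%:E|%E)) //.
by apply: measurableT_comp => //; exact/measurable_EFinP.
Qed.

Lemma law_sub_gaussian (f : S -> R) sg : measurable_fun setT f ->
  sub_gaussian P (f \o v) sg -> sub_gaussian Q (f \o u) sg.
Proof.
move=> mf [sg0 fint fsg]; split => //; first exact: law_integrable.
move=> l; rewrite (law_expectation mf).
rewrite (@law_expectation (fun s => expR (l * (f s - fine ('E_P[(fun w => f (v w))%R])%E)))).
  exact: fsg.
apply: measurableT_comp => //; apply: measurable_funM => //.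
exact: measurable_funB.
Qed.

Lemma law_mean_vec k (f : S -> 'cV[R]_k) :
  (forall i, measurable_fun setT (fun s => f s i 0)) ->
  mean_vec Q (f \o u) = mean_vec P (f \o v).
Proof. by move=> mf; apply/colP => i; rewrite !mxE (law_expectation (mf i)). Qed.

Lemma law_covmx k (f : S -> 'cV[R]_k) :
  (forall i, measurable_fun setT (fun s => f s i 0)) ->
  covmx Q (f \o u) = covmx P (f \o v).
Proof.
move=> mf; apply/matrixP => i j; rewrite !mxE /= covariance.unlock.
rewrite (law_expectation (mf i)) (law_expectation (mf j)).
set a := fine ('E_P[(fun w => f (v w) i 0)%R])%E.
set b := fine ('E_P[(fun w => f (v w) j 0)%R])%E.
pose g s := (f s i 0 - a) * (f s j 0 - b).
have mg : measurable_fun setT g by apply: measurable_funM; apply: measurable_funB.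
congr fine; transitivity ('E_Q[(fun w => g (u w))%R])%E.
  by congr expectation.
by rewrite (law_expectation mg); congr expectation.
Qed.

End SameLaw.

(** * Integrated consequences of the conditional hypotheses *)

Section ConditionalExpectation.
Context d (T : measurableType d) (R : realType) (P : probability T R).
Variables (M : nat) (Y : T -> 'cV[R]_M).
Hypothesis mY : random_vector Y.
Local Open Scope ereal_scope.

(** The events V > 0 and V < 0 belong to the sigma-algebra of Y, so the integral of |V| over each of
    them is 0. *)
Lemma is_cond_exp_eq0 (U V : T -> R) : is_cond_exp P (sigma_of Y) U V ->
  (forall A, sigma_of Y A -> \int[P]_(w in A) (U w)%:E = 0) ->
  {ae P, forall w, V w = 0%R}.
Proof.
move=> [_ intV mV eqV] U0.
(* Here e is the sign of the points of B; it is used at 1 and -1 for the two open half-lines. *)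
have null (e : R) (B : set R) : measurable B -> (forall x, B x -> 0 < e * x)%R ->
    {ae P, forall w, ~ B (V w)}.
  move=> mB eB; have sA : sigma_of Y (V @^-1` B) by exact: mV.
  have mA := sigma_of_measurable mY sA.
  have iV : P.-integrable (V @^-1` B) (EFin \o V) by exact: integrableS intV.
  have : \int[P]_(w in V @^-1` B) `|e%:E * (V w)%:E| = 0.
    under eq_integral => w /[!inE] Bw.
      rewrite -EFinM /= ger0_norm ?EFinM; last exact/ltW/eB.
      over.
    by rewrite integralZl // eqV // U0 // mule0.
  have mf : measurable_fun (V @^-1` B) (fun w => e%:E * (V w)%:E).
    by apply: measurable_funeM; case/integrableP : iV.
  move=> /(ae_eq_integral_abs _ mA mf).
  apply: filterS => w h Bw; have := h Bw => /=.
  rewrite -EFinM => -[] e0; have := eB _ Bw.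
  by rewrite e0 ltxx.
have h1 := null 1%R `]0%R, +oo[%classic (measurable_itv _).
have h2 := null (-1)%R `]-oo, 0%R[%classic (measurable_itv _).
have {}h1 : {ae P, forall w, ~ `]0%R, +oo[%classic (V w)}.
  by apply: h1 => x /=; rewrite in_itv /= andbT mul1r.
have {}h2 : {ae P, forall w, ~ `]-oo, 0%R[%classic (V w)}.
  by apply: h2 => x /=; rewrite in_itv /= mulN1r oppr_gt0.
apply: filterS2 h1 h2 => w /= /negP + /negP.
rewrite !in_itv /= andbT -!leNgt => V0 V0'.
by apply/eqP; rewrite eq_le V0 V0'.
Qed.

(** Over an event of the sigma-algebra of Y, the integrals of X and of its conditional mean f agree,
    and f = L Y almost surely, so the residual integrates to 0. *)
Lemma cond_exp_residual0 (N : nat) (X : T -> 'cV[R]_N) (L : 'M[R]_(N, M))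
    (EY f : T -> 'cV[R]_N) :
  square_integrable P Y ->
  is_cond_exp_vec P (sigma_of Y) (fun w => X w - L *m Y w)%R EY ->
  is_cond_exp_vec P (sigma_of Y) X f ->
  {ae P, forall w, L *m Y w = f w} ->
  {ae P, forall w, EY w = 0%R}.
Proof.
move=> Y2 hEY hf hae.
have coord i : {ae P, forall w, EY w i 0%R = 0%R}.
  apply: is_cond_exp_eq0 (hEY i) _ => A sA.
  have mA := sigma_of_measurable mY sA.
  have [intX intf _ eqf] := hf i.
  have intLY : P.-integrable setT (fun w => ((L *m Y w) i 0%R)%:E).
    apply/Lfun1_integrable; apply: Lfun_subset12.
      exact: fin_num_measure.
    exact: (square_integrable_mulmx L Y2).
  have -> : \int[P]_(w in A) ((X w - L *m Y w) i 0)%R%:E =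
      \int[P]_(w in A) ((X w i 0%R)%:E - ((L *m Y w) i 0%R)%:E).
    by apply: eq_integral => w _; rewrite !mxE.
  rewrite integralB //; last 2 first.
  - exact: (integrableS measurableT mA _ intX).
  - exact: (integrableS measurableT mA _ intLY).
  have -> : \int[P]_(w in A) ((L *m Y w) i 0%R)%:E = \int[P]_(w in A) (f w i 0%R)%:E.
    apply: ae_eq_integral => //.
    - by apply: measurable_funTS; case/integrableP : intLY.
    - by apply: measurable_funTS; case/integrableP : intf.
    - by apply: filterS hae => w -> _.
  rewrite eqf // subee //.
  have := integrableS measurableT mA _ intX => /(_ (fun _ _ => Logic.I)) iX.
  exact: integrable_fin_num.
have := filter_forall (ae_filter_ringOfSetsType P) coord.
apply: filterS; by move=> w h; apply/colP => i; rewrite h mxE.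
Qed.

(** The integrated form of hypothesis (i): given Y, the exponential weight of E, normalized by its
    C-sub-Gaussian bound, has mean at most 1. *)
Lemma cond_sub_gaussian (N : nat) (E EY : T -> 'cV[R]_N) (C : 'M[R]_N)
    (G : 'cV[R]_N -> T -> R) :
  posdefmx C -> random_vector E ->
  {ae P, forall w, EY w = 0%R} ->
  (forall a, is_cond_exp P (sigma_of Y)
     (fun w => expR ((a^T *m (invsqrtmx C *m (E w - EY w))) 0 0))%R (G a)) ->
  {ae P, forall w a, (G a w <= expR (norm2 a ^+ 2 / 2))%R} ->
  forall (b : 'cV[R]_N) (B : set (M.-tuple R)), measurable B ->
  \int[P]_w (\1_B (ctup (Y w)) * expR ((b^T *m E w) 0 0 - (b^T *m C *m b) 0 0 / 2))%:E
    <= P ((ctup \o Y) @^-1` B).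
Proof.
move=> Cp mE EY0 hG Gle b B mB.
pose A := (ctup \o Y) @^-1` B.
have sA : sigma_of Y A by apply/sigma_ofP; exists B.
have mA := sigma_of_measurable mY sA.
have [[SQ _] QQ] := sqrtmxP (posdefmx_psd Cp).
have Qu := sqrtmx_unit Cp.
(* This a undoes the whitening: a^T C^(-1/2) = b^T and |a|^2 = b^T C b. *)
pose a := sqrtmx C *m b.
have aC : (norm2 a ^+ 2 = (b^T *m C *m b) 0 0)%R.
  by rewrite norm2_sqr /a trmx_mul SQ -{3}QQ !mulmxA.
have aE w : (a^T *m (invsqrtmx C *m (E w - EY w)) = b^T *m (E w - EY w))%R.
  by rewrite /a trmx_mul SQ /invsqrtmx -mulmxA mulKVmx.
have [intU intG mG eqG] := hG a.
set k := ((b^T *m C *m b) 0 0 / 2)%R.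
have mbE : measurable_fun setT (fun w => (b^T *m E w) 0%R 0%R).
  exact: (random_vector_mulmx b^T mE).
have mind : measurable_fun setT (fun w => \1_B (ctup (Y w)) : R).
  by apply: (measurableT_comp (measurable_indic mB)); exact: measurable_ctup.
have -> : \int[P]_w (\1_B (ctup (Y w)) * expR ((b^T *m E w) 0 0 - k))%R%:E =
    (expR (- k))%:E * \int[P]_(w in A) (expR ((b^T *m E w) 0 0))%R%:E.
  rewrite [X in _ * X]integral_mkcond -ge0_integralZl_EFin ?expR_ge0 //.
  - apply: eq_integral => w _; rewrite patchE expRD indicE.
    have -> : (ctup (Y w) \in B) = (w \in A) by apply/idP/idP; rewrite !inE.
    by case: ifPn => _; rewrite ?mul1r ?mul0r ?mule0 // -EFinM mulrC.
  - by move=> w _; rewrite patchE; case: ifPn => // _; rewrite lee_fin expR_ge0.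
  - apply/(measurable_restrictT _ mA)/measurable_funTS/measurable_EFinP.
    exact: (measurableT_comp (@measurable_expR R)).
have -> : \int[P]_(w in A) (expR ((b^T *m E w) 0 0))%R%:E =
    \int[P]_(w in A) (expR ((a^T *m (invsqrtmx C *m (E w - EY w))) 0 0))%R%:E.
  apply: ae_eq_integral => //.
  - apply: measurable_funTS; apply/measurable_EFinP.
    exact: (measurableT_comp (@measurable_expR R)).
  - by apply: measurable_funTS; case/integrableP : intU.
  - by apply: filterS EY0 => w e _; rewrite aE e subr0.
rewrite -eqG //.
have le1 : \int[P]_(w in A) (G a w)%:E <= \int[P]_(w in A) (expR k)%:E.
  have iA : P.-integrable A (EFin \o G a) by exact: integrableS intG.
  (* The version [G a] may be negative on a null set, so its positive part is what gets compared
     almost everywhere. *)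
  apply: (@le_trans _ _ (\int[P]_(w in A) (EFin \o G a)^\+ w)).
    apply: le_integral => //; first exact: integrable_funepos.
    by move=> w _; rewrite funeposE le_max lexx.
  apply: ae_ge0_le_integral => //.
  - by apply: measurable_funepos; case/integrableP : iA.
  - move: Gle; apply: filterS => w /(_ a); rewrite aC -/k => h _.
    by rewrite funeposE ge_max /= !lee_fin h expR_ge0.
apply: (@le_trans _ _ ((expR (- k))%:E * \int[P]_(w in A) (expR k)%:E)).
  by apply: lee_wpmul2l => //; rewrite lee_fin expR_ge0.
rewrite integral_cst // muleA -EFinM -expRD addNr expR0 mul1e.
by [].
Qed.

End ConditionalExpectation.

(** * The linear model *)

Section IndependentCovariance.
Context d (T : measurableType d) (R : realType) (P : probability T R).
Local Open Scope ereal_scope.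

(** The joint law is the product of the marginal laws by uniqueness of product measures; Fubini for
    the integrable function (x, y) -> x y then factors the integral. *)
Lemma expectation_indepM (U V : {mfun T >-> R}) :
  (forall A B, measurable A -> measurable B ->
    P (U @^-1` A `&` V @^-1` B) = P (U @^-1` A) * P (V @^-1` B)) ->
  (U : T -> R) \in Lfun P 1 -> (V : T -> R) \in Lfun P 1 ->
  (U \* V)%R \in Lfun P 1 ->
  'E_P[U \* V] = 'E_P[U] * 'E_P[V].
Proof.
move=> indep U1 V1 UV1.
pose f (z : R * R) : \bar R := (z.1 * z.2)%:E.
have mf : measurable_fun setT f.
  apply/measurable_EFinP/measurable_funM; [exact: measurable_fst|exact: measurable_snd].
have mUV : measurable_fun setT (fun w => (U w, V w)) by exact: measurable_fun_pair.
pose pUV := image_measure P mUV.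
have law B : measurable B -> (distribution P U \x distribution P V) B = pUV B.
  by move=> mB; apply: product_measure_unique.
have iUV : P.-integrable setT (EFin \o (U \* V)%R) by apply/Lfun1_integrable.
have ifp : (distribution P U \x distribution P V).-integrable setT f.
  apply/integrableP; split => //.
  have /integrableP[_] := iUV; congr (_ < _).
  transitivity (\int[pUV]_z `|f z|).
    rewrite ge0_integral_pushforward //.
    exact: measurableT_comp.
  by apply: eq_measure_integral => B mB _; apply/esym; exact: law.
have -> : 'E_P[U \* V] = \int[distribution P U \x distribution P V]_z f z.
  rewrite unlock; transitivity (\int[pUV]_z f z).
    by rewrite integral_pushforward.
  by apply: eq_measure_integral => B mB _; apply/esym; exact: law.
rewrite -(integral12_prod_meas1 ifp).
have iV : P.-integrable setT (EFin \o V) by apply/Lfun1_integrable.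
have iU : P.-integrable setT (EFin \o U) by apply/Lfun1_integrable.
have iV' : (distribution P V).-integrable setT (EFin : R -> \bar R).
  by apply: integrable_pushforward => //; exact: measurable_EFin.
have iU' : (distribution P U).-integrable setT (EFin : R -> \bar R).
  by apply: integrable_pushforward => //; exact: measurable_EFin.
have EV : \int[distribution P V]_y y%:E = 'E_P[V].
  by rewrite unlock integral_pushforward.
have EU : \int[distribution P U]_y y%:E = 'E_P[U].
  by rewrite unlock integral_pushforward.
transitivity (\int[distribution P U]_x (x%:E * 'E_P[V])).
  apply: eq_integral => x _; rewrite /fubini_F /f /=.
  under eq_integral do rewrite EFinM.
  by rewrite integralZl // EV.
have /fineK <- : 'E_P[V] \is a fin_num by exact: expectation_fin_num.
by rewrite integralZr // EU.
Qed.

Lemma covmx_indep k l (X : T -> 'cV[R]_k) (Z : T -> 'cV[R]_l) :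
  square_integrable P X -> square_integrable P Z -> independent2 P X Z ->
  covmx P (fun w => col_mx (X w) (Z w)) = block_mx (covmx P X) 0 0 (covmx P Z).
Proof.
move=> X2 Z2 XZ.
have L1 (U : T -> R) : U \in Lfun P 2%:E -> U \in Lfun P 1.
  by apply: Lfun_subset12; exact: fin_num_measure.
have mX := square_integrable_measurable X2.
have mZ := square_integrable_measurable Z2.
have cXZ i j : covariance P (fun w => X w i 0%R) (fun w => Z w j 0%R) = 0.
  pose U : {mfun T >-> R} := HB.pack (fun w => X w i 0%R)
    (isMeasurableFun.Build _ _ _ _ (fun w => X w i 0%R) (mX i)).
  pose V : {mfun T >-> R} := HB.pack (fun w => Z w j 0%R)
    (isMeasurableFun.Build _ _ _ _ (fun w => Z w j 0%R) (mZ j)).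
  have UV1 : ((U : T -> R) \* V)%R \in Lfun P 1 by exact: (Lfun2_mul_Lfun1 (X2 i) (Z2 j)).
  rewrite (covarianceE (L1 _ (X2 i)) (L1 _ (Z2 j)) UV1).
  have -> : 'E_P[(fun w => X w i 0%R) * (fun w => Z w j 0%R)] = 'E_P[U \* V] by [].
  rewrite (@expectation_indepM U V _ (L1 _ (X2 i)) (L1 _ (Z2 j)) UV1).
    by rewrite subee // fin_numM ?expectation_fin_num ?L1 //; [exact: X2|exact: Z2].
  move=> A B mA mB; apply: XZ; apply/sigma_ofP.
    exists ((fun t : k.-tuple R => tnth t i) @^-1` A).
      by rewrite -[X in measurable X]setTI; exact: measurable_tnth.
    by apply/seteqP; split => w /=; rewrite tnth_mktuple.
  exists ((fun t : l.-tuple R => tnth t j) @^-1` B).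
    by rewrite -[X in measurable X]setTI; exact: measurable_tnth.
  by apply/seteqP; split => w /=; rewrite tnth_mktuple.
have eu i : (fun w => col_mx (X w) (Z w) (lshift l i) 0%R) = (fun w => X w i 0%R).
  by apply/funext => w; rewrite col_mxEu.
have ed i : (fun w => col_mx (X w) (Z w) (rshift k i) 0%R) = (fun w => Z w i 0%R).
  by apply/funext => w; rewrite col_mxEd.
apply/matrixP => i j; rewrite mxE.
case: (split_ordP i) => i' ->; case: (split_ordP j) => j' ->; rewrite ?eu ?ed.
- by rewrite block_mxEul mxE.
- by rewrite block_mxEur mxE cXZ.
- by rewrite block_mxEdl mxE covarianceC cXZ.
- by rewrite block_mxEdr mxE.
Qed.

End IndependentCovariance.

Section LinearModel.
Context d (T : measurableType d) (R : realType) (P : probability T R).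
Variables (N M : nat) (X : T -> 'cV[R]_N) (Z : T -> 'cV[R]_M) (A : 'M[R]_(M, N)).
Hypothesis XZ : independent2 P X Z.
Hypothesis X2 : square_integrable P X.
Hypothesis Z2 : square_integrable P Z.
Hypothesis X0 : mean_vec P X = 0.
Hypothesis Z0 : mean_vec P Z = 0.
Hypothesis CX : covmx P X \in unitmx.
Hypothesis CZ : covmx P Z \in unitmx.

Let Y := fun w => A *m X w + Z w.
(** Y and all linear estimation errors are linear images of this stacked vector, whose covariance is
    block diagonal, so that moments are computed once. *)
Let V := fun w => col_mx (X w) (Z w).

Let V2 : square_integrable P V.
Proof.
move=> i; case: (split_ordP i) => j ->.
  have -> : (fun w => V w (lshift M j) 0) = (fun w => X w j 0).
    by apply/funext => w; rewrite /V col_mxEu.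
  exact: X2.
have -> : (fun w => V w (rshift N j) 0) = (fun w => Z w j 0).
  by apply/funext => w; rewrite /V col_mxEd.
exact: Z2.
Qed.

Let V0 : mean_vec P V = 0.
Proof.
apply/colP => i; rewrite !mxE; case: (split_ordP i) => j ->.
  have -> : (fun w => V w (lshift M j) 0) = (fun w => X w j 0).
    by apply/funext => w; rewrite /V col_mxEu.
  by have := congr1 (fun m : 'cV_N => m j 0) X0; rewrite !mxE.
have -> : (fun w => V w (rshift N j) 0) = (fun w => Z w j 0).
  by apply/funext => w; rewrite /V col_mxEd.
by have := congr1 (fun m : 'cV_M => m j 0) Z0; rewrite !mxE.
Qed.

Let YE : Y = (fun w => row_mx A 1%:M *m V w).
Proof. by apply/funext => w; rewrite /V mul_row_col mul1mx. Qed.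

Lemma linear_model_square_integrable : square_integrable P Y.
Proof. by rewrite YE; exact: square_integrable_mulmx. Qed.

Lemma linear_model_mean : mean_vec P Y = 0.
Proof. by rewrite YE mean_vec_mulmx // V0 mulmx0. Qed.

Lemma linear_model_cov : covmx P Y = A *m covmx P X *m A^T + covmx P Z.
Proof.
rewrite YE covmx_mulmx // covmx_indep // tr_row_mx mul_row_block mul_row_col trmx1.
by rewrite !mulmx0 addr0 add0r mul1mx mulmx1.
Qed.

Lemma linear_model_cov_posdef : posdefmx (covmx P Y).
Proof.
rewrite linear_model_cov addrC; apply: posdefmxDl; first exact: covmx_posdef.
have := @psdmx_congr _ _ _ (covmx P X) A^T (covmx_psd X2); by rewrite trmxK.
Qed.

Lemma mse_linear (Th : 'M[R]_(M, N)) :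
  mse P X Y Th =
    (\tr (error_covmx A (covmx P X) (covmx P Z)) +
     normF (sqrtmx (covmx P Y) *m (Th - lmmse_mx A (covmx P X) (covmx P Z))) ^+ 2)%:E.
Proof.
(* The error Th^T Y - X is L V, whose covariance is the left side of [lmmse_mx_opt]. *)
pose L := row_mx (Th^T *m A - 1%:M) Th^T.
rewrite /mse.
have -> : (fun w => norm2 (Th^T *m Y w - X w) ^+ 2) = (fun w => norm2 (L *m V w) ^+ 2).
  apply/funext => w; rewrite /L /V mul_row_col mulmxBl mul1mx /Y mulmxDr mulmxA.
  by rewrite addrAC.
rewrite expectation_norm2; last 2 first.
- exact: square_integrable_mulmx.
- by rewrite mean_vec_mulmx // V0 mulmx0.
rewrite covmx_mulmx // covmx_indep // /L tr_row_mx mul_row_block mul_row_col trmxK.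
rewrite !mulmx0 addr0 add0r lmmse_mx_opt; [|exact: covmx_posdef|exact: covmx_posdef].
rewrite raddfD /=; congr (_ + _)%:E.
have [[ST _] SS] := sqrtmxP (posdefmx_psd linear_model_cov_posdef).
rewrite -linear_model_cov normF_sqr trmx_mul ST -[X in _ *m X *m _]SS.
by rewrite !mulmxA.
Qed.

End LinearModel.

(** * Measurable matrix functions *)

Section MeasurableMatrices.
Context d (S : measurableType d) (R : realType).

Definition measurable_mx p q (F : S -> 'M[R]_(p, q)) :=
  forall i j, measurable_fun setT (fun s => F s i j).

Lemma measurable_mx_cst p q (A : 'M[R]_(p, q)) : measurable_mx (fun=> A).
Proof. by move=> i j; exact: measurable_cst. Qed.

Lemma measurable_mx_tr p q (F : S -> 'M[R]_(p, q)) :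
  measurable_mx F -> measurable_mx (fun s => (F s)^T).
Proof.
move=> mF i j; have -> : (fun s => (F s)^T i j) = (fun s => F s j i).
  by apply/funext => s; rewrite mxE.
exact: mF.
Qed.

Lemma measurable_mx_mul p q r (F : S -> 'M[R]_(p, q)) (G : S -> 'M[R]_(q, r)) :
  measurable_mx F -> measurable_mx G -> measurable_mx (fun s => F s *m G s).
Proof.
move=> mF mG i j.
have -> : (fun s => (F s *m G s) i j) = (fun s => \sum_k F s i k * G s k j).
  by apply/funext => s; rewrite mxE.
by apply: measurable_sum => k; apply: measurable_funM; [exact: mF|exact: mG].
Qed.

Lemma measurable_mx_scale p q (f : S -> R) (F : S -> 'M[R]_(p, q)) :
  measurable_fun setT f -> measurable_mx F -> measurable_mx (fun s => f s *: F s).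
Proof.
move=> mf mF i j.
have -> : (fun s => (f s *: F s) i j) = (fun s => f s * F s i j).
  by apply/funext => s; rewrite mxE.
by apply: measurable_funM => //; exact: mF.
Qed.

Lemma measurable_det p (F : S -> 'M[R]_p) : measurable_mx F ->
  measurable_fun setT (fun s => \det (F s)).
Proof.
move=> mF; apply: measurable_sum => u; apply: measurable_funM => //.
by apply: measurable_prod => i _; exact: mF.
Qed.

Lemma measurable_adj p (F : S -> 'M[R]_p) : measurable_mx F ->
  measurable_mx (fun s => \adj (F s)).
Proof.
move=> mF i j.
have -> : (fun s => (\adj (F s)) i j) =
    (fun s => (-1) ^+ (j + i) * \det (row' j (col' i (F s)))).
  by apply/funext => s; rewrite mxE.
apply: measurable_funM => //; apply: measurable_det => a b.
have -> : (fun s => row' j (col' i (F s)) a b) = (fun s => F s (lift j a) (lift i b)).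
  by apply/funext => s; rewrite !mxE.
exact: mF.
Qed.

(* Unlike invmx, this total form of the inverse is a measurable function of the
   entries. *)
Definition adj_inv p (G : 'M[R]_p) : 'M[R]_p := (\det G)^-1 *: \adj G.

Lemma adj_invE p (G : 'M[R]_p) : G \in unitmx -> adj_inv G = invmx G.
Proof. by rewrite /adj_inv /invmx => ->. Qed.

Lemma measurable_adj_inv p (F : S -> 'M[R]_p) : measurable_mx F ->
  measurable_mx (fun s => adj_inv (F s)).
Proof.
move=> mF; apply: measurable_mx_scale; last exact: measurable_adj.
exact: (measurableT_comp (@measurable_invr R) (measurable_det mF)).
Qed.

Lemma cvg_sumr (I : Type) (r : seq I) (f : I -> nat -> R) (l : I -> R) :
  (forall i, f i @ \oo --> l i) ->
  (fun k => \sum_(i <- r) f i k) @ \oo --> \sum_(i <- r) l i.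
Proof. by move=> fl; apply: cvg_big => //; exact: add_continuous. Qed.

Lemma cvg_mulmx p q r (F : nat -> 'M[R]_(p, q)) (G : nat -> 'M[R]_(q, r))
    (A : 'M[R]_(p, q)) (B : 'M[R]_(q, r)) :
  (forall i j, (fun k => F k i j) @ \oo --> A i j) ->
  (forall i j, (fun k => G k i j) @ \oo --> B i j) ->
  forall i j, (fun k => (F k *m G k) i j) @ \oo --> (A *m B) i j.
Proof.
move=> FA GB i j; rewrite mxE.
have -> : (fun k => (F k *m G k) i j) = (fun k => \sum_l F k i l * G k l j).
  by apply/funext => k; rewrite mxE.
by apply: cvg_sumr => l; apply: cvgM; [exact: FA|exact: GB].
Qed.

Lemma cvg_tr p q (F : nat -> 'M[R]_(p, q)) (A : 'M[R]_(p, q)) :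
  (forall i j, (fun k => F k i j) @ \oo --> A i j) ->
  forall i j, (fun k => (F k)^T i j) @ \oo --> A^T i j.
Proof.
move=> FA i j; rewrite mxE.
have -> : (fun k => (F k)^T i j) = (fun k => F k j i) by apply/funext => k; rewrite mxE.
exact: FA.
Qed.

Lemma cvg_mxtrace p (F : nat -> 'M[R]_p) (A : 'M[R]_p) :
  (forall i j, (fun k => F k i j) @ \oo --> A i j) ->
  (fun k => \tr (F k)) @ \oo --> \tr A.
Proof. by move=> FA; apply: cvg_sumr => i; exact: FA. Qed.

(* Integer vectors give the rational ones by homogeneity, and these are dense. *)
Lemma quad_int_ge0 p (H : 'M[R]_p) :
  (forall z : 'cV[int]_p, 0 <= ((map_mx intr z)^T *m H *m map_mx intr z) 0 0) ->
  forall v : 'cV[R]_p, 0 <= (v^T *m H *m v) 0 0.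
Proof.
move=> H0 v; pose u k : 'cV[R]_p := \col_i grid k (v i 0).
have uv i j : (fun k => u k i j) @ \oo --> v i j.
  have -> : (fun k => u k i j) = (fun k => grid k (v i 0)).
    by apply/funext => k; rewrite mxE.
  rewrite ord1; exact: grid_cvg.
have cq : (fun k => ((u k)^T *m H *m u k) 0 0) @ \oo --> (v^T *m H *m v) 0 0.
  apply: cvg_mulmx => //; apply: cvg_mulmx; first exact: cvg_tr.
  by move=> i j; exact: cvg_cst.
rewrite -(cvg_lim _ cq) //; apply: limr_ge; first by apply/cvg_ex; eexists; exact: cq.
apply: nearW => k; pose z : 'cV[int]_p := \col_i Num.floor (k.+1%:R * v i 0).
have -> : u k = k.+1%:R^-1 *: map_mx intr z.
  by apply/colP => i; rewrite !mxE mulrC.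
have -> : (k.+1%:R^-1 *: map_mx intr z)^T = k.+1%:R^-1 *: (map_mx intr z)^T :> 'rV[R]_p.
  by rewrite linearZ.
rewrite -!scalemxAl -scalemxAr scalerA mxE.
by rewrite mulr_ge0 // mulr_ge0 // invr_ge0 ler0n.
Qed.

(** By [quad_int_ge0] the uncountable intersection over v reduces to countably many integer vectors.
    This makes the event of a lower bound on W^T W measurable. *)
Lemma measurable_quad_ge0 p (H : S -> 'M[R]_p) : measurable_mx H ->
  measurable [set s | forall v : 'cV[R]_p, 0 <= (v^T *m H s *m v) 0 0].
Proof.
move=> mH.
have -> : [set s | forall v : 'cV[R]_p, 0 <= (v^T *m H s *m v) 0 0] =
   ~` \bigcup_(z : 'cV[int]_p)
     [set s | ((map_mx intr z)^T *m H s *m map_mx intr z : 'M[R]_1) 0 0 < 0].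
  apply/seteqP; split => s /=.
    by move=> h [z _ /=]; rewrite ltNge h.
  move=> h; apply: quad_int_ge0 => z; rewrite leNgt; apply/negP => hz.
  by apply: h; exists z.
apply: measurableC; apply: countable_bigcupT_measurable => // z.
have mq : measurable_fun setT
    (fun s => ((map_mx intr z)^T *m H s *m map_mx intr z : 'M[R]_1) 0 0).
  apply: measurable_mx_mul; last exact: measurable_mx_cst.
  by apply: measurable_mx_mul => //; exact: measurable_mx_cst.
rewrite -[X in measurable X]setTI.
have -> : [set s | ((map_mx intr z)^T *m H s *m map_mx intr z : 'M[R]_1) 0 0 < 0] =
   (fun s => ((map_mx intr z)^T *m H s *m map_mx intr z : 'M[R]_1) 0 0) @^-1` `]-oo, 0[%classic.
  by apply/seteqP; split => s /=; rewrite in_itv.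
exact: mq.
Qed.

End MeasurableMatrices.

(** * Tail of the quadratic form *)

Section ChernoffExponent.
Variable R : realType.

(** The witness y / (x + 2 b y), with x and y the roots of v2 and t, minimizes the exponent. There 1
    - 2 e b = x / (x + 2 b y), and the minimum is exactly - t. *)
Lemma chernoff_exponent (v1 v2 b t : R) : 0 < v2 -> 0 <= b -> 0 < t ->
  exists e : R, [/\ 0 < e, 2 * e * b < 1 &
    e * v1 + e ^+ 2 * v2 / (1 - 2 * e * b)
      - e * (v1 + 2 * Num.sqrt (v2 * t) + 2 * b * t) = - t].
Proof.
move=> v20 b0 t0; pose x := Num.sqrt v2; pose y := Num.sqrt t.
have x0 : 0 < x by rewrite sqrtr_gt0.
have y0 : 0 < y by rewrite sqrtr_gt0.
have x2 : v2 = x ^+ 2 by rewrite sqr_sqrtr // ltW.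
have y2 : t = y ^+ 2 by rewrite sqr_sqrtr // ltW.
have xy : Num.sqrt (v2 * t) = x * y by rewrite sqrtrM // ltW.
have by0 : 0 <= 2 * b * y by rewrite !mulr_ge0 // ltW.
have D0 : 0 < x + 2 * b * y by rewrite ltr_wpDr.
have eb : 1 - 2 * (y / (x + 2 * b * y)) * b = x / (x + 2 * b * y).
  by field; rewrite gt_eqF.
exists (y / (x + 2 * b * y)); split.
- by rewrite divr_gt0.
- by rewrite -subr_gt0 eb divr_gt0.
- by rewrite eb xy x2 y2; field; rewrite !gt_eqF.
Qed.

End ChernoffExponent.

(** * Exponential moment and tail of a data-dependent linear image of the errors *)

Section QuadraticTail.
Context d (T : measurableType d) dS (S : measurableType dS) (R : realType)
  (Q : probability T R).
Variables (n N M : nat) (y : T -> S) (xi : T -> 'M[R]_(n, N)) (C : 'M[R]_N).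
Variables (Good : set S) (B : S -> 'M[R]_(M, n)) (kap : R).
Hypothesis N0 : (0 < N)%N.
Hypothesis M0 : (0 < M)%N.
Hypothesis my : measurable_fun setT y.
Hypothesis mxi : measurable_mx xi.
Hypothesis Cp : posdefmx C.
Hypothesis mGood : measurable Good.
Hypothesis mB : measurable_mx B.
Hypothesis kap0 : 0 < kap.
Hypothesis BGood : forall s, Good s -> forall v : 'cV[R]_M,
  (((B s)^T *m v)^T *m ((B s)^T *m v)) 0 0 <= kap * (v^T *m v) 0 0.
Hypothesis H : forall (a : 'M[R]_(n, N)) (D : set S), measurable D ->
  (\int[Q]_w (\1_D (y w) *
     expR (\tr (a *m (xi w)^T) - \tr (a *m C *m a^T) / 2))%:E <= Q (y @^-1` D))%E.

Let mcomp p q (F : S -> 'M[R]_(p, q)) : measurable_mx F ->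
  measurable_mx (fun w => F (y w)).
Proof. by move=> mF i j; exact: (measurableT_comp (mF i j) my). Qed.

Let mtrace p (F : T -> 'M[R]_p) : measurable_mx F ->
  measurable_fun setT (fun w => \tr (F w)).
Proof. by move=> mF; apply: measurable_sum => i; exact: mF. Qed.

Let m1Good : measurable_fun setT (fun w => \1_Good (y w) : R).
Proof. by apply: (measurableT_comp (measurable_indic mGood)). Qed.

Let mweight (a : S -> 'M[R]_(n, N)) : measurable_mx a ->
  measurable_fun setT
    (fun w => expR (\tr (a (y w) *m (xi w)^T) - \tr (a (y w) *m C *m (a (y w))^T) / 2)).
Proof.
move=> ma; apply: (measurableT_comp (@measurable_expR R)); apply: measurable_funB.
  apply: mtrace; apply: measurable_mx_mul; first exact: mcomp.
  exact: measurable_mx_tr.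
apply: measurable_funM => //; apply: mtrace; apply: measurable_mx_mul.
  apply: measurable_mx_mul; first exact: mcomp.
  exact: measurable_mx_cst.
by apply: measurable_mx_tr; exact: mcomp.
Qed.

(** Hypothesis [H] for a coefficient matrix that depends on the conditioning data, obtained from
    [freezing]. *)
Let frozen (a : S -> 'M[R]_(n, N)) : measurable_mx a ->
  (\int[Q]_w (\1_Good (y w) *
     expR (\tr (a (y w) *m (xi w)^T) - \tr (a (y w) *m C *m (a (y w))^T) / 2))%:E <= 1)%E.
Proof.
move=> ma.
have mG : measurable (y @^-1` Good).
  by rewrite -[X in measurable X]setTI; exact: my.
apply: le_trans (probability_le1 Q mG).
apply: (freezing my (L := fun a w =>
  expR (\tr (a *m (xi w)^T) - \tr (a *m C *m a^T) / 2))) => //.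
move=> a_ a0 w cva; apply: (cvg_comp _ expR); last exact: continuous_expR.
apply: cvgB.
  apply: cvg_mxtrace; apply: cvg_mulmx => // i j; exact: cvg_cst.
apply: cvgM; last exact: cvg_cst.
apply: cvg_mxtrace; apply: cvg_mulmx; last exact: cvg_tr.
by apply: cvg_mulmx => // i j; exact: cvg_cst.
Qed.

Let z (U : 'M[R]_N) (w : T) : 'M[R]_(M, N) := B (y w) *m xi w *m U.

Let mz U : measurable_mx (z U).
Proof.
apply: measurable_mx_mul; last exact: measurable_mx_cst.
by apply: measurable_mx_mul => //; exact: mcomp.
Qed.

(** A linear form in the entries of B xi U is a linear form in xi whose coefficient matrix B^T g U^T
    depends on the data. *)
Let trace_lin U (g : 'M[R]_(M, N)) w :
  \tr ((B (y w))^T *m g *m U^T *m (xi w)^T) =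
  \sum_(i : 'I_M * 'I_N) g i.1 i.2 * z U w i.1 i.2.
Proof.
rewrite -!mulmxA mxtrace_mulC -mulmxA -!trmx_mul.
rewrite /mxtrace -(pair_bigA _ (fun k j => g k j * z U w k j)) /=.
apply: eq_bigr => k _; rewrite mxE; apply: eq_bigr => j _; congr (_ * _).
by rewrite mxE /z !mulmxA.
Qed.

(** In the eigenbasis of C the trace is the sum of lambda_j times the squared length of the j-th
    column of B^T g, and [BGood] bounds that length by the one of the column of g. *)
Let trace_quad (U : 'M[R]_N) (lam : 'rV[R]_N) (g : 'M[R]_(M, N)) s :
  U^T *m U = 1%:M -> C = U *m diag_mx lam *m U^T -> (forall j, 0 < lam 0 j) -> Good s ->
  forall a, a = (B s)^T *m g *m U^T ->
  \tr (a *m C *m a^T) <= \sum_(i : 'I_M * 'I_N) kap * lam 0 i.2 * g i.1 i.2 ^+ 2.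
Proof.
move=> UU CE lam0 Gs a ->; pose h := (B s)^T *m g.
have -> : (B s)^T *m g *m U^T *m C *m ((B s)^T *m g *m U^T)^T = h *m diag_mx lam *m h^T.
  rewrite -/h CE trmx_mul trmxK !mulmxA -(mulmxA h) UU mulmx1.
  by rewrite -(mulmxA _ U^T) UU mulmx1.
rewrite -(pair_bigA _ (fun k j => kap * lam 0 j * g k j ^+ 2)) /= exchange_big /=.
have -> : \tr (h *m diag_mx lam *m h^T) = \sum_j lam 0 j * ((col j h)^T *m col j h) 0 0.
  rewrite /mxtrace; under eq_bigr do rewrite mxE.
  rewrite exchange_big /=; apply: eq_bigr => j _; rewrite quad_id mulr_sumr.
  apply: eq_bigr => i _; rewrite mul_mx_diag !mxE expr2; ring.
apply: ler_sum => j _.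
have -> : \sum_k kap * lam 0 j * g k j ^+ 2 = lam 0 j * (kap * ((col j g)^T *m col j g) 0 0).
  rewrite quad_id !mulr_sumr; apply: eq_bigr => k _; rewrite mxE; ring.
rewrite ler_wpM2l ?(ltW (lam0 j)) //.
have -> : col j h = (B s)^T *m col j g by rewrite /h !colE mulmxA.
exact: BGood.
Qed.

Let mgf (U : 'M[R]_N) (lam : 'rV[R]_N) (eta : R) :
  U^T *m U = 1%:M -> C = U *m diag_mx lam *m U^T -> (forall j, 0 < lam 0 j) ->
  0 <= eta -> (forall j, 2 * eta * (kap * lam 0 j) < 1) ->
  (\int[Q]_w (\1_Good (y w) * expR (eta * normF (B (y w) *m xi w) ^+ 2))%:E <=
   (\prod_(i : 'I_M * 'I_N) (Num.sqrt (1 - 2 * eta * (kap * lam 0 i.2)))^-1)%:E)%E.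
Proof.
move=> UU CE lam0 eta0 etalam.
have UU' := mulmx1C UU.
have -> : (\int[Q]_w (\1_Good (y w) * expR (eta * normF (B (y w) *m xi w) ^+ 2))%:E =
  \int[Q]_w (\1_Good (y w) *
    expR (eta * \sum_(i <- index_enum ('I_M * 'I_N)%type) z U w i.1 i.2 ^+ 2))%:E)%E.
  apply: eq_integral => w _; congr (_ * expR (_ * _))%:E.
  rewrite -(normF_orth _ UU') -/(z U w) /normF sqr_sqrtr.
    by rewrite (pair_bigA _ (fun k j => z U w k j ^+ 2)).
  by apply: sumr_ge0 => i _; apply: sumr_ge0 => j _; exact: sqr_ge0.
rewrite -[leRHS]mul1e -EFinM.
apply: (@gaussian_linearization_seq _ _ R Q _ (index_enum ('I_M * 'I_N)%type)
  (fun i w => z U w i.1 i.2) (fun i => kap * lam 0 i.2)) => //.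
- exact: index_enum_uniq.
- by move=> i; exact: mz.
move=> g; pose gm := \matrix_(k, j) g (k, j) : 'M[R]_(M, N).
have gmE i : gm i.1 i.2 = g i by rewrite mxE -surjective_pairing.
(* The coefficient matrix of [trace_lin]; its dependence on s is what calls for [frozen]. *)
pose a s := (B s)^T *m gm *m U^T.
have ma : measurable_mx a.
  apply: measurable_mx_mul; last exact: measurable_mx_cst.
  apply: measurable_mx_mul; last exact: measurable_mx_cst.
  exact: measurable_mx_tr.
rewrite mul1r; set K := expR _.
apply: (@le_trans _ _ (\int[Q]_w (K%:E * (\1_Good (y w) *
     expR (\tr (a (y w) *m (xi w)^T) - \tr (a (y w) *m C *m (a (y w))^T) / 2))%:E))%E).
  apply: ge0_le_integral => //.
  - apply/measurable_EFinP/measurable_funM => //.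
    apply: (measurableT_comp (@measurable_expR R)); apply: measurable_sum => i.
    by apply: measurable_funM => //; exact: mz.
  - by apply: measurable_funeM; apply/measurable_EFinP/measurable_funM => //; exact: mweight.
  move=> w _; rewrite -EFinM lee_fin mulrCA.
  (* Off [Good] both integrands vanish; on it [trace_quad] shows that K pays for the normalizing
     term. *)
  rewrite indicE; case: (boolP (y w \in Good)) => [|_]; last by rewrite !mul0r.
  rewrite inE => Gw; rewrite !mul1r -expRD ler_expR.
  have trl : \tr (a (y w) *m (xi w)^T) = \sum_(i : 'I_M * 'I_N) g i * z U w i.1 i.2.
    by rewrite trace_lin; apply: eq_bigr => i _; rewrite gmE.
  have trq : \tr (a (y w) *m C *m (a (y w))^T) <=
      \sum_(i : 'I_M * 'I_N) kap * lam 0 i.2 * g i ^+ 2.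
    apply: le_trans (@trace_quad U lam gm (y w) UU CE lam0 Gw _ erefl) _.
    by rewrite le_eqVlt; apply/orP; left; apply/eqP/eq_bigr => i _; rewrite gmE.
  by rewrite -mulr_suml trl; move: trq; lra.
rewrite ge0_integralZl_EFin ?expR_ge0 //; last first.
  by apply/measurable_EFinP/measurable_funM => //; exact: mweight.
rewrite -[leRHS]mule1; apply: lee_wpmul2l; first by rewrite lee_fin expR_ge0.
exact: frozen.
Qed.

Lemma quadratic_tail (t : R) : 0 < t ->
  (Q (y @^-1` Good `&` [set w | (kap * (\tr C * M%:R
        + 2 * Num.sqrt (M%:R * \tr (C *m C) * t) + 2 * spectral_norm C * t)
        < normF (B (y w) *m xi w) ^+ 2)%R]) <= (expR (- t))%:E)%E.
Proof.
move=> t0; have [U [lam [UU CE lam0]]] := posdefmx_spectral Cp.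
have [trC trC2] := tr_spectral UU CE.
set b := spectral_norm C.
have lamb j : lam 0 j <= b by exact: spectral_norm_ge UU CE.
have b0 : 0 <= b by apply: le_trans (lamb (Ordinal N0)); exact: ltW.
have trC2_gt0 : 0 < \tr (C *m C).
  rewrite trC2 (bigD1 (Ordinal N0)) //= ltr_pwDl ?exprn_gt0 //.
  by apply: sumr_ge0 => j _; exact: sqr_ge0.
have v20 : 0 < M%:R * \tr (C *m C) by rewrite mulr_gt0 ?ltr0n.
have [e [e0 eb eE]] := chernoff_exponent (\tr C * M%:R) v20 b0 t0.
set K := _ + 2 * b * t in eE *.
(* The scaling by kap cancels: eta kap lambda_j = e lambda_j. *)
pose eta := e / kap.
have eta0 : 0 < eta by rewrite divr_gt0.
have etak x : 2 * eta * (kap * x) = 2 * e * x.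
  by rewrite /eta; field; rewrite gt_eqF.
have elam j : 2 * e * lam 0 j < 1.
  by apply: le_lt_trans eb; rewrite ler_wpM2l // mulr_ge0 // ltW.
have := @mgf U lam eta UU CE lam0 (ltW eta0) _.
have etalam j : 2 * eta * (kap * lam 0 j) < 1 by rewrite etak.
move=> /(_ etalam) Hmgf.
set A := _ `&` _.
have mN : measurable_fun setT (fun w => normF (B (y w) *m xi w) ^+ 2).
  have -> : (fun w => normF (B (y w) *m xi w) ^+ 2) =
      (fun w => \tr ((B (y w) *m xi w)^T *m (B (y w) *m xi w))).
    by apply/funext => w; rewrite normF_sqr.
  have mBx : measurable_mx (fun w => B (y w) *m xi w).
    by apply: measurable_mx_mul => //; exact: mcomp.
  by apply: mtrace; apply: measurable_mx_mul => //; exact: measurable_mx_tr.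
have mA : measurable A.
  apply: measurableI; first by rewrite -[X in measurable X]setTI; exact: my.
  rewrite -[X in measurable X]setTI.
  have -> : [set w | kap * K < normF (B (y w) *m xi w) ^+ 2] =
    (fun w => normF (B (y w) *m xi w) ^+ 2) @^-1` `](kap * K), +oo[%classic.
    by apply/seteqP; split => w /=; rewrite in_itv /= andbT.
  exact: mN.
have mexp : measurable_fun setT
    (fun w => \1_Good (y w) * expR (eta * normF (B (y w) *m xi w) ^+ 2) : R).
  apply: measurable_funM => //; apply: (measurableT_comp (@measurable_expR R)).
  exact: measurable_funM.
(* Markov's inequality for the exponential: on A one has eta |B xi|_F^2 > eta kap K = e K. *)
have QA : (Q A <= (expR (- (e * K)))%:E *
    \int[Q]_w (\1_Good (y w) * expR (eta * normF (B (y w) *m xi w) ^+ 2))%:E)%E.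
  rewrite -ge0_integralZl_EFin ?expR_ge0 //; last exact/measurable_EFinP.
  have -> : Q A = (\int[Q]_w (\1_A w)%:E)%E by rewrite integral_indic // setIT.
  apply: ge0_le_integral => //.
  - exact/measurable_EFinP.
  - by apply: measurable_funeM; exact/measurable_EFinP.
  move=> w _; rewrite -EFinM lee_fin [leLHS]indicE.
  case: (boolP (w \in A)) => [|_]; last by rewrite !mulr_ge0 ?expR_ge0.
  rewrite inE => -[/= Gw Nw]; rewrite indicE mem_set // mul1r -expRD.
  rewrite -[leLHS]expR0 ler_expR addrC subr_ge0.
  have -> : e * K = eta * (kap * K) by rewrite /eta; field; rewrite gt_eqF.
  by rewrite ler_wpM2l // ltW.
apply: (le_trans QA).
apply: (@le_trans _ _ ((expR (- (e * K)))%:E *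
   (\prod_(i : 'I_M * 'I_N) (Num.sqrt (1 - 2 * eta * (kap * lam 0 i.2)))^-1)%:E)%E).
  by apply: lee_wpmul2l => //; rewrite lee_fin expR_ge0.
rewrite -EFinM lee_fin.
have prodle : \prod_(i : 'I_M * 'I_N) (Num.sqrt (1 - 2 * eta * (kap * lam 0 i.2)))^-1 <=
    expR (e * (\tr C * M%:R) + e ^+ 2 * (M%:R * \tr (C *m C)) / (1 - 2 * e * b)).
  (* Each factor is bounded by [invsqrt_le_expR] at u = e lambda_j, and lambda_j by b in the
     denominator, so that the exponents add up to traces. *)
  apply: (@le_trans _ _ (\prod_(i : 'I_M * 'I_N)
      expR (e * lam 0 i.2 + e ^+ 2 * lam 0 i.2 ^+ 2 / (1 - 2 * e * b)))).
    apply: ler_prod => -[k j] _ /=; rewrite invr_ge0 sqrtr_ge0 /= etak.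
    have u1 : 2 * (e * lam 0 j) < 1 by rewrite mulrA.
    have u0 : 0 <= e * lam 0 j by rewrite mulr_ge0 // ltW.
    rewrite -[2 * e * _]mulrA; apply: le_trans (invsqrt_le_expR u1 u0) _.
    rewrite ler_expR lerD2l exprMn; apply: ler_wpM2l.
      by apply: mulr_ge0; exact: sqr_ge0.
    rewrite lef_pV2 ?posrE ?subr_gt0 // lerD2l lerN2 -(mulrA 2 e).
    by rewrite ler_wpM2l // ler_wpM2l // (ltW e0).
  rewrite -expR_sum ler_expR.
  rewrite -(pair_bigA _ (fun (k : 'I_M) j =>
    e * lam 0 j + e ^+ 2 * lam 0 j ^+ 2 / (1 - 2 * e * b))) /=.
  rewrite sumr_const card_ord big_split /= -mulr_sumr -trC -mulr_suml -mulr_sumr -trC2.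
  rewrite -mulr_natl le_eqVlt; apply/orP; left; apply/eqP; field.
  by rewrite subr_eq0 gt_eqF.
apply: le_trans (ler_wpM2l _ prodle) _; first exact: expR_ge0.
by rewrite -expRD ler_expR addrC eE.
Qed.

End QuadraticTail.

(** * The training sample *)

Section Samples.
Context d (T : measurableType d) d' (Omega : measurableType d') (R : realType)
  (P : probability T R) (Q : probability Omega R).
Variables (N M n : nat) (X : T -> 'cV[R]_N) (Y : T -> 'cV[R]_M).
Variables (Xs : 'I_n -> Omega -> 'cV[R]_N) (Ys : 'I_n -> Omega -> 'cV[R]_M).
Hypothesis mX : random_vector X.
Hypothesis mY : random_vector Y.
Hypothesis mXs : forall i, random_vector (Xs i).
Hypothesis mYs : forall i, random_vector (Ys i).
Hypothesis indep : independent_family Q (fun i w => col_mx (Xs i w) (Ys i w)).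
Hypothesis same : forall i, same_law Q P (fun w => col_mx (Xs i w) (Ys i w))
                                         (fun w => col_mx (X w) (Y w)).

Definition untuple k (t : k.-tuple R) : 'cV[R]_k := \col_i tnth t i.

Lemma ctupK k : cancel (@ctup R k) (@untuple k).
Proof. by move=> v; apply/colP => i; rewrite mxE tnth_mktuple. Qed.

Lemma measurable_untuple k : measurable_mx (@untuple k).
Proof.
move=> i j; have -> : (fun t : k.-tuple R => untuple t i j) = (fun t => tnth t i).
  by apply/funext => t; rewrite mxE.
exact: measurable_tnth.
Qed.

Definition xpart (t : (N + M).-tuple R) : 'cV[R]_N := usubmx (untuple t).
Definition ypart (t : (N + M).-tuple R) : 'cV[R]_M := dsubmx (untuple t).

Lemma measurable_xpart : measurable_mx xpart.
Proof.
move=> i j; have -> : (fun t => xpart t i j) = (fun t => untuple t (lshift M i) j).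
  by apply/funext => t; rewrite mxE.
exact: measurable_untuple.
Qed.

Lemma measurable_ypart : measurable_mx ypart.
Proof.
move=> i j; have -> : (fun t => ypart t i j) = (fun t => untuple t (rshift N i) j).
  by apply/funext => t; rewrite mxE.
exact: measurable_untuple.
Qed.

Let smp i w := ctup (col_mx (Xs i w) (Ys i w)).
Let smpP w := ctup (col_mx (X w) (Y w)).
Let code (t : (N + M).-tuple R) : M.-tuple R := ctup (ypart t).

Let msmp i : measurable_fun setT (smp i).
Proof. by apply: (@measurable_ctup _ _ _ _ (fun w => col_mx (Xs i w) (Ys i w))); exact: random_vector_col_mx. Qed.

Let msmpP : measurable_fun setT smpP.
Proof. by apply: (@measurable_ctup _ _ _ _ (fun w => col_mx (X w) (Y w))); exact: random_vector_col_mx. Qed.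

Let mcode : measurable_fun setT code.
Proof. by apply: (@measurable_ctup _ _ _ _ ypart) => i; exact: measurable_ypart. Qed.

Let xsmp i w : xpart (smp i w) = Xs i w.
Proof. by rewrite /xpart /smp ctupK col_mxKu. Qed.

Let ysmp i w : ypart (smp i w) = Ys i w.
Proof. by rewrite /ypart /smp ctupK col_mxKd. Qed.

Let xsmpP w : xpart (smpP w) = X w.
Proof. by rewrite /xpart /smpP ctupK col_mxKu. Qed.

Let ysmpP w : ypart (smpP w) = Y w.
Proof. by rewrite /ypart /smpP ctupK col_mxKd. Qed.

Let law i B : measurable B -> Q (smp i @^-1` B) = P (smpP @^-1` B).
Proof.
move=> mB; have := @same i (ctup @^-1` B); apply.
by apply/sigma_ofP; exists B.
Qed.

Let ismp : indep_maps Q smp.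
Proof. exact: (independent_family_indep_maps indep). Qed.

(** The observations are read off the tuple of full samples, the form in which [indep_domination]
    takes its coarser data. *)
Definition ysample (w : Omega) : n.-tuple (M.-tuple R) := map_tuple code (tmap smp w).

Lemma measurable_ysample : measurable_fun setT ysample.
Proof.
apply: measurableT_comp; first exact: measurable_map_tuple.
exact: measurable_tmap.
Qed.

Definition ymatrix (t : n.-tuple (M.-tuple R)) : 'M[R]_(n, M) :=
  \matrix_(i, j) tnth (tnth t i) j.

Lemma measurable_ymatrix : measurable_mx ymatrix.
Proof.
move=> i j; have -> : (fun t => ymatrix t i j) =
    (fun u : M.-tuple R => tnth u j) \o (fun t : n.-tuple (M.-tuple R) => tnth t i).
  by apply/funext => t; rewrite mxE.
apply: measurableT_comp; exact: measurable_tnth.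
Qed.

Lemma ymatrix_ysample w : ymatrix (ysample w) = sample_mx Ys w.
Proof.
apply/matrixP => i j; rewrite !mxE tnth_map tnth_mktuple /code tnth_mktuple.
by rewrite ysmp.
Qed.

Section Error.
Variables (L : 'M[R]_(N, M)) (C : 'M[R]_N).
Hypothesis cond : forall (b : 'cV[R]_N) (B : set (M.-tuple R)), measurable B ->
  (\int[P]_w (\1_B (ctup (Y w)) *
     expR ((b^T *m (X w - L *m Y w)) 0 0 - (b^T *m C *m b) 0 0 / 2))%:E
    <= P ((ctup \o Y) @^-1` B))%E.

(** Both traces are sums over the rows of a, so the exponential is a product of one weight per
    sample. Each weight is dominated by [cond], transported by equality of laws. *)
Lemma sample_error_mgf (a : 'M[R]_(n, N)) (D : set (n.-tuple (M.-tuple R))) :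
  measurable D ->
  (\int[Q]_w (\1_D (ysample w) *
     expR (\tr (a *m (sample_mx Xs w - sample_mx Ys w *m L^T)^T)
           - \tr (a *m C *m a^T) / 2))%:E <= Q (ysample @^-1` D))%E.
Proof.
move=> mD; pose err t := xpart t - L *m ypart t.
have merr : measurable_mx err.
  move=> i j; have -> : (fun t => err t i j) = (fun t => xpart t i j - (L *m ypart t) i j).
    by apply/funext => t; rewrite !mxE.
  apply: measurable_funB; first exact: measurable_xpart.
  by apply: measurable_mx_mul; [exact: measurable_mx_cst|exact: measurable_ypart].
pose phi i t := expR ((row i a *m err t) 0 0 - (row i a *m C *m (row i a)^T) 0 0 / 2).
have mphi i : measurable_fun setT (phi i).
  apply: (measurableT_comp (@measurable_expR R)); apply: measurable_funB => //.
  by apply: measurable_mx_mul => //; exact: measurable_mx_cst.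
have phi0 i t : 0 <= phi i t by exact: expR_ge0.
have Hphi i B : measurable B ->
    (\int[Q]_w (\1_B (code (smp i w)) * phi i (smp i w))%:E <=
     Q ((code \o smp i) @^-1` B))%E.
  move=> mB.
  have mf : measurable_fun setT (fun t => (\1_B (code t) * phi i t)%:E).
    apply/measurable_EFinP/measurable_funM => //.
    exact: (measurableT_comp (measurable_indic mB) mcode).
  rewrite (law_integral (msmp i) msmpP (@law i) mf).
  have mcB : measurable (code @^-1` B).
    by rewrite -[X in measurable X]setTI; exact: mcode.
  rewrite (comp_preimage B (smp i) code) (law i mcB).
  have -> : smpP @^-1` (code @^-1` B) = (ctup \o Y) @^-1` B.
    by apply/seteqP; split => w /=; rewrite /code ysmpP.
  apply: le_trans (cond (row i a)^T mB); rewrite trmxK le_eqVlt; apply/orP; left.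
  by apply/eqP/eq_integral => w _; rewrite /code /phi /err ysmpP xsmpP.
have mfD : measurable_fun setT (fun t : n.-tuple (M.-tuple R) => (\1_D t : R)%:E).
  by apply/measurable_EFinP; exact: measurable_indic.
have D0 (t : n.-tuple (M.-tuple R)) : (0 <= (\1_D t : R)%:E)%E by rewrite lee_fin.
have mpre : measurable (ysample @^-1` D).
  by rewrite -[X in measurable X]setTI; exact: measurable_ysample.
have -> : Q (ysample @^-1` D) = (\int[Q]_w (\1_D (ysample w))%:E)%E.
  by rewrite (integral_indic _ measurableT mpre) setIT.
apply: le_trans (indep_domination msmp ismp mcode mphi phi0 Hphi mfD D0).
rewrite le_eqVlt; apply/orP; left; apply/eqP/eq_integral => w _.
rewrite -EFinM; congr (_ * _)%:E.
rewrite -expR_sum; congr expR; rewrite sumrB -mulr_suml; congr (_ - _ / _).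
  rewrite /mxtrace; apply: eq_bigr => i _; rewrite !mxE; apply: eq_bigr => j _.
  rewrite mxE /err xsmp ysmp !mxE; congr (_ * (_ - _)).
  by apply: eq_bigr => k _; rewrite !mxE mulrC.
rewrite /mxtrace; apply: eq_bigr => i _; rewrite -row_mul !mxE.
by apply: eq_bigr => j _; rewrite !mxE.
Qed.

End Error.

(** * Smallest singular value of the whitened observations *)

Section Whitening.
Variables (c rho : R).
Hypothesis hc : singular_value_constant c.
Hypothesis Y2 : square_integrable P Y.
Hypothesis Y0 : mean_vec P Y = 0.
Hypothesis CYp : posdefmx (covmx P Y).
Hypothesis M0 : (0 < M)%N.
Hypothesis Ysub : sub_gaussian_vec P (fun w => invsqrtmx (covmx P Y) *m Y w) rho.

Lemma invsqrtmx_tr : (invsqrtmx (covmx P Y))^T = invsqrtmx (covmx P Y).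
Proof.
have [[ST _] _] := sqrtmxP (posdefmx_psd CYp).
by rewrite /invsqrtmx trmx_inv ST.
Qed.

(** The rows are the vectors C_YY^(-1/2) Y_i, which inherit independence from the pairs, and
    centring, identity covariance and the sub-Gaussian bound from the law of Y. *)
Lemma whitened_singular_values (t : R) : 0 <= t ->
  with_prob_ge Q (1 - 2 * expR (- t))
    [set w | Num.sqrt n%:R - c * rho ^+ 2 * (Num.sqrt M%:R + Num.sqrt t)
      <= sigma_min (sample_mx Ys w *m invsqrtmx (covmx P Y))].
Proof.
move=> t0; set Si := invsqrtmx _.
pose g t := Si *m ypart t.
have mg : measurable_mx g.
  by apply: measurable_mx_mul; [exact: measurable_mx_cst|exact: measurable_ypart].
have rowE i : (fun w => (row i (sample_mx Ys w *m Si))^T) = g \o smp i.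
  apply/funext => w; rewrite /g /= ysmp row_mul trmx_mul invsqrtmx_tr -/Si.
  by congr (_ *m _); apply/colP => j; rewrite !mxE.
have gP : g \o smpP = (fun w => Si *m Y w).
  by apply/funext => w; rewrite /g /= ysmpP.
have [[ST _] SS] := sqrtmxP (posdefmx_psd CYp).
have Su := sqrtmx_unit CYp.
have mctg : measurable_fun setT (ctup \o g).
  by apply: (@measurable_ctup _ _ _ _ g) => i; exact: mg.
have [|i|B [mB Bsub] QB] := @hc _ _ Q n M rho (fun w => sample_mx Ys w *m Si) t M0 _ _ t0.
- move=> A sA.
  (* An event of the i-th whitened row is pulled back to one of the i-th pair, for which
     independence is known. *)
  have sA' i : exists B, measurable B /\ A i = (ctup \o g \o smp i) @^-1` B.
    by have := sA i; rewrite rowE => /sigma_ofP[B mB AB]; exists B.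
  have [B BE] := boolp.choice sA'.
  have mB i : measurable (B i) by case: (BE i).
  have AE i : A i = (ctup \o g \o smp i) @^-1` B i by case: (BE i).
  pose B' i := (ctup \o g) @^-1` B i.
  have mB' i : measurable (B' i) by rewrite -[X in measurable X]setTI; exact: mctg.
  have := ismp mB'.
  have AE' i : A i = smp i @^-1` B' i by rewrite AE.
  by under eq_bigcapr do rewrite -AE'; under eq_bigr do rewrite -AE'.
- split.
  + move=> a a1.
    have h : sub_gaussian P ((fun t => (a^T *m g t) 0 0) \o smpP) rho.
      have -> : (fun t => (a^T *m g t) 0 0) \o smpP = (fun w => (a^T *m (Si *m Y w)) 0 0).
        by apply/funext => w; rewrite /g /= ysmpP.
      exact: Ysub.
    have -> : (fun w => (a^T *m (row i (sample_mx Ys w *m Si))^T) 0 0) =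
        (fun t => (a^T *m g t) 0 0) \o smp i.
      by apply/funext => w /=; have := congr1 (fun f => f w) (rowE i) => /= ->.
    apply: (law_sub_gaussian (msmp i) msmpP (@law i)) h.
    by apply: measurable_mx_mul => //; exact: measurable_mx_cst.
  + rewrite rowE (law_mean_vec (msmp i) msmpP (@law i)); last by move=> j; exact: mg.
    by rewrite gP mean_vec_mulmx // Y0 mulmx0.
  + rewrite rowE (law_covmx (msmp i) msmpP (@law i)); last by move=> j; exact: mg.
    rewrite gP covmx_mulmx // invsqrtmx_tr -[X in _ *m X *m _]SS /Si /invsqrtmx.
    by rewrite mulmxA mulVmx // mul1mx mulmxV.
- by exists B => //; split => // w /Bsub[].
Qed.

End Whitening.

End Samples.

Theorem proposition5p15 (R : realType) (N M : nat) (hN : (0 < N)%N)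
    (hM : (0 < M)%N)
    (* the absolute constant *)
    (c : R) (hc0 : 0 < c) (hc : singular_value_constant c)
    (* the model Y = A X + Z *)
    (d : measure_display) (T : measurableType d) (P : probability T R)
    (X : T -> 'cV[R]_N) (Z : T -> 'cV[R]_M) (A : 'M[R]_(M, N))
    (hXZ : independent2 P X Z)
    (hX2 : square_integrable P X) (hZ2 : square_integrable P Z)
    (hX0 : mean_vec P X = 0) (hZ0 : mean_vec P Z = 0)
    (hCXX : covmx P X \in unitmx) (hCZZ : covmx P Z \in unitmx)
    (hXd : has_continuous_density P X) (hZd : has_continuous_density P Z) :
  let Y := fun w => A *m X w + Z w in
  let ThetaStar := lmmse_mx A (covmx P X) (covmx P Z) in
  let CEE := error_covmx A (covmx P X) (covmx P Z) in
  let E := fun w => X w - ThetaStar^T *m Y w in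
  forall
    (* the conditional mean E[E | Y] and the estimator E[X | Y] *)
    (EY : T -> 'cV[R]_N) (hEY : is_cond_exp_vec P (sigma_of Y) E EY)
    (fMMSE : T -> 'cV[R]_N) (hMMSE : is_cond_exp_vec P (sigma_of Y) X fMMSE)
    (* (i) *)
    (C : 'M[R]_N) (hC : posdefmx C)
    (hi : exists G : 'cV[R]_N -> T -> R,
      (forall a : 'cV[R]_N,
        is_cond_exp P (sigma_of Y)
          (fun w => expR ((a^T *m (invsqrtmx C *m (E w - EY w))) 0 0)) (G a))
      /\ {ae P, forall w, forall a : 'cV[R]_N,
            G a w <= expR (norm2 a ^+ 2 / 2)})
    (* (ii) *)
    (mu : 'cV[R]_N)
    (hii : forall i : 'I_N, {ae P, forall w, `|EY w i 0| <= mu i 0})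
    (* (iii) *)
    (rho : R)
    (hiii : sub_gaussian_vec P (fun w => invsqrtmx (covmx P Y) *m Y w) rho)
    (* the LMMSE and MMSE estimators coincide *)
    (hcoinc : {ae P, forall w, ThetaStar^T *m Y w = fMMSE w})
    (eps : R) (heps : 0 < eps) (delta : R) (hdelta : 0 < delta < 1)
    (n : nat)
    (hn : (Num.sqrt ((\tr C * M%:R
                      + 2 * Num.sqrt (M%:R * \tr (C *m C) * ln (3 / delta))
                      + 2 * spectral_norm C * ln (3 / delta))
                     / (\tr CEE * eps))
           + c * rho ^+ 2 * (Num.sqrt M%:R + Num.sqrt (ln (3 / delta)))) ^+ 2
          <= n%:R)
    (* the independent samples and the least squares estimator *)
    (d' : measure_display) (Omega : measurableType d')
    (Q : probability Omega R)
    (Xs : 'I_n -> Omega -> 'cV[R]_N) (Ys : 'I_n -> Omega -> 'cV[R]_M)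
    (hXs : forall i, random_vector (Xs i))
    (hYs : forall i, random_vector (Ys i))
    (hindep : independent_family Q (fun i w => col_mx (Xs i w) (Ys i w)))
    (hlaw : forall i, same_law Q P (fun w => col_mx (Xs i w) (Ys i w))
                                   (fun w => col_mx (X w) (Y w)))
    (ThetaHat : Omega -> 'M[R]_(M, N))
    (hLS : forall w, least_squares (sample_mx Ys w) (sample_mx Xs w)
                                   (ThetaHat w)),
  with_prob_ge Q (1 - delta)
    [set w | (mse P X Y (ThetaHat w) <= (\tr CEE * (1 + eps))%:E)%E].
Proof.
move=> Y ThetaStar CEE E EY hEY fMMSE hMMSE C hC [G [hG Gle]] mu _ rho hiii hcoinc.
move=> eps heps delta /andP[delta0 delta1] n hn d' Omega Q Xs Ys hXs hYs hindep hlaw.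
move=> ThetaHat hLS.
have CXp := covmx_posdef hX2 hCXX.
have CZp := covmx_posdef hZ2 hCZZ.
have mX := square_integrable_measurable hX2.
have Y2 : square_integrable P Y := linear_model_square_integrable A hX2 hZ2.
have mY := square_integrable_measurable Y2.
have Y0 : mean_vec P Y = 0 := linear_model_mean A hX2 hZ2 hX0 hZ0.
have CYp : posdefmx (covmx P Y) := linear_model_cov_posdef A hXZ hX2 hZ2 hCZZ.
have [_ _ CEEp] := lmmse_mxP A CXp CZp; rewrite -/CEE in CEEp.
have trE : 0 < \tr CEE := posdefmx_tr_gt0 hN CEEp.
have mE : random_vector E.
  have -> : E = (fun w => row_mx 1%:M (- ThetaStar^T) *m col_mx (X w) (Y w)).
    by apply/funext => w; rewrite mul_row_col mul1mx mulNmx.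
  by apply: random_vector_mulmx; exact: random_vector_col_mx.
have EY0 := cond_exp_residual0 mY Y2 hEY hMMSE hcoinc.
have cond := cond_sub_gaussian mY hC mE EY0 hG Gle.
have mgf := sample_error_mgf mX mY hXs hYs hindep hlaw cond.
(* This t makes exp (-t) a third of delta: two thirds go to the singular values and one to the
   tail. *)
set t := ln (3 / delta) in hn.
have t0 : 0 < t.
  by rewrite ln_gt0 // ltr_pdivlMr // mul1r (lt_trans delta1) // ltr1n.
have expt : expR (- t) = delta / 3.
  by rewrite expRN lnK ?posrE ?divr_gt0 // invf_div.
set K := _ + 2 * spectral_norm C * t in hn.
have [U [lam [UU CE lam0]]] := posdefmx_spectral hC.
have K0 : 0 < K.
  rewrite /K -addrA ltr_pwDl //.
    by rewrite mulr_gt0 ?ltr0n // posdefmx_tr_gt0.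
  rewrite addr_ge0 // ?mulr_ge0 ?sqrtr_ge0 ?(ltW t0) //.
  exact: le_trans (ltW (lam0 (Ordinal hN))) (spectral_norm_ge (Ordinal hN) UU CE).
set s := Num.sqrt (K / _) in hn.
have s0 : 0 < s by rewrite sqrtr_gt0 divr_gt0 // mulr_gt0.
have s2 : s ^+ 2 = K / (\tr CEE * eps) by rewrite sqr_sqrtr // divr_ge0 ?mulr_ge0 ?ltW.
set u := c * rho ^+ 2 * _ in hn.
have u0 : 0 <= u.
  apply: mulr_ge0; last by apply: addr_ge0; exact: sqrtr_ge0.
  by apply: mulr_ge0; [exact: ltW|exact: sqr_ge0].
(* This is the condition (s + u)^2 <= n: the guaranteed lower bound on sigma_min is at least s. *)
have su : s <= Num.sqrt n%:R - u.
  rewrite lerBrDr -(@ler_pXn2r _ 2) ?nnegrE ?sqrtr_ge0 ?addr_ge0 ?(ltW s0) //.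
  by rewrite [leRHS]sqr_sqrtr // ler0n.
have n0 : (0 < n)%N.
  by rewrite -(ltr0n R) (lt_le_trans _ hn) // exprn_gt0 // ltr_pwDl.
have [B [mB Bsub] QB] := whitened_singular_values mX mY hXs hYs hindep hlaw hc
  Y2 Y0 CYp hM hiii (ltW t0).
have [[ST _] SS] := sqrtmxP (posdefmx_psd CYp).
have Su := sqrtmx_unit CYp.
pose W y := @ymatrix R M n y *m invsqrtmx (covmx P Y).
pose H y := (W y)^T *m W y - (s ^+ 2)%:M.
(* The event [B] lives on Omega and need not be determined by the observations. [Good] is a
   measurable set of observations, and its preimage contains [B]. *)
pose Good := [set y | forall v : 'cV[R]_M, 0 <= (v^T *m H y *m v) 0 0].
have mW : measurable_mx W.
  by apply: measurable_mx_mul; [exact: measurable_ymatrix|exact: measurable_mx_cst].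
have mG : measurable_mx (fun y => (W y)^T *m W y).
  by apply: measurable_mx_mul => //; exact: measurable_mx_tr.
have mH : measurable_mx H.
  move=> i j; have -> : (fun y => H y i j) =
      (fun y => ((W y)^T *m W y) i j - (s ^+ 2)%:M i j).
    by apply/funext => y; rewrite !mxE.
  by apply: measurable_funB => //; exact: mG.
have mGood : measurable Good := measurable_quad_ge0 mH.
have GoodE y : Good y <-> forall v : 'cV[R]_M,
    s ^+ 2 * (v^T *m v) 0 0 <= (v^T *m ((W y)^T *m W y) *m v) 0 0.
  have e (v : 'cV[R]_M) : (v^T *m H y *m v) 0 0 =
      (v^T *m ((W y)^T *m W y) *m v) 0 0 - s ^+ 2 * (v^T *m v) 0 0.
    rewrite /H mulmxBr mulmxBl mul_mx_scalar -scalemxAl.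
    by move: (_ *m _ *m v) (v^T *m v) => a b; rewrite !mxE.
  by split => h v; have := h v; rewrite e subr_ge0.
(* Measurable everywhere, and equal to the pseudo-inverse of W on [Good], where the Gram matrix is
   invertible. *)
pose pinv y := adj_inv ((W y)^T *m W y) *m (W y)^T.
have pinvE y : Good y -> pinv y = invmx ((W y)^T *m W y) *m (W y)^T.
  by move=> /GoodE/(quad_lower_unit s0) Gu; rewrite /pinv adj_invE.
have mpinv : measurable_mx pinv.
  apply: measurable_mx_mul; last exact: measurable_mx_tr.
  exact: measurable_adj_inv.
pose y := ysample Xs Ys.
have my : measurable_fun setT y := measurable_ysample hXs hYs.
pose xi w := sample_mx Xs w - sample_mx Ys w *m ThetaStar.
have mXi : measurable_mx xi.
  move=> i j; have -> : (fun w => xi w i j) =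
      (fun w => Xs i w j 0 - \sum_k Ys i w k 0 * ThetaStar k j).
    by apply/funext => w; rewrite !mxE; congr (_ - _); apply: eq_bigr => k _; rewrite mxE.
  apply: measurable_funB; first exact: hXs.
  by apply: measurable_sum => k; apply: measurable_funM => //; exact: hYs.
have kap0 : 0 < s ^- 2 by rewrite invr_gt0 exprn_gt0.
have pinvGood z : Good z -> forall v : 'cV[R]_M,
    (((pinv z)^T *m v)^T *m ((pinv z)^T *m v)) 0 0 <= s ^- 2 * (v^T *m v) 0 0.
  by move=> Gz v; apply: (pinv_quad_le s0 ((GoodE z).1 Gz)); rewrite pinvE.
have Hmgf (a : 'M[R]_(n, N)) (D : set (n.-tuple (M.-tuple R))) : measurable D ->
  (\int[Q]_w (\1_D (y w) *
     expR (\tr (a *m (xi w)^T) - \tr (a *m C *m a^T) / 2))%:E <= Q (y @^-1` D))%E.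
  by move=> mD; have := mgf a D mD; rewrite trmxK.
have tail := quadratic_tail hN hM my mXi hC mGood mpinv kap0 pinvGood Hmgf t0.
rewrite -/K in tail.
have mGy : measurable (y @^-1` Good).
  by rewrite -[X in measurable X]setTI; exact: my.
pose F := y @^-1` Good `&` [set w | normF (pinv (y w) *m xi w) ^+ 2 <= s ^- 2 * K].
have mpx : measurable_fun setT (fun w => normF (pinv (y w) *m xi w) ^+ 2).
  have -> : (fun w => normF (pinv (y w) *m xi w) ^+ 2) =
      (fun w => \sum_i \sum_j (pinv (y w) *m xi w) i j ^+ 2).
    apply/funext => w; rewrite /normF sqr_sqrtr //.
    by apply: sumr_ge0 => i _; apply: sumr_ge0 => j _; exact: sqr_ge0.
  apply: measurable_sum => i; apply: measurable_sum => j; apply: measurable_funX.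
  apply: measurable_mx_mul => // a b; exact: (measurableT_comp (mpinv a b) my).
have mle : measurable [set w | normF (pinv (y w) *m xi w) ^+ 2 <= s ^- 2 * K].
  rewrite -[X in measurable X]setTI.
  have -> : [set w | normF (pinv (y w) *m xi w) ^+ 2 <= s ^- 2 * K] =
    (fun w => normF (pinv (y w) *m xi w) ^+ 2) @^-1` `]-oo, (s ^- 2 * K)]%classic.
    by apply/seteqP; split => w /=; rewrite in_itv.
  exact: mpx.
exists F; first split.
- exact: measurableI.
- move=> w [/= Gw Nw].
  have YW : sample_mx Ys w = W (y w) *m sqrtmx (covmx P Y).
    by rewrite /W ymatrix_ysample -mulmxA mulVmx // mulmx1.
  have Gu := quad_lower_unit s0 ((GoodE _).1 Gw).
  have := least_squares_unique ThetaStar n0 ST Su YW Gu (hLS w).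
  rewrite -pinvE // -/(xi w) => DE.
  rewrite (mse_linear A hXZ hX2 hZ2 hX0 hZ0 hCXX hCZZ) lee_fin -/ThetaStar -/CEE DE.
  (* The choice of s turns s^-2 K into eps tr C_EE. *)
  rewrite mulrDr mulr1 lerD2l (le_trans Nw) // s2 invf_div.
  by rewrite divfK // gt_eqF.
- have QGood : ((1 - 2 * expR (- t))%:E <= Q (y @^-1` Good))%E.
    apply: le_trans QB _; apply: le_measure; rewrite ?inE // => w /Bsub /= Bw.
    apply/GoodE; apply: sigma_min_quad (ltW s0) _.
    by rewrite /W ymatrix_ysample (le_trans su).
  have splitG : Q (y @^-1` Good) = (Q F + Q (y @^-1` Good `&`
      [set w | (s ^- 2 * K < normF (pinv (y w) *m xi w) ^+ 2)%R]))%E.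
    have mF : measurable F by exact: measurableI.
    set F' := _ `&` [set w | _ < _].
    have mF' : measurable F'.
      apply: measurableI => //.
      have -> : [set w | s ^- 2 * K < normF (pinv (y w) *m xi w) ^+ 2] =
          ~` [set w | normF (pinv (y w) *m xi w) ^+ 2 <= s ^- 2 * K].
        by apply/seteqP; split => w /=; rewrite ltNge => /negP.
      exact: measurableC.
    have FF' : F `&` F' = set0.
      by apply/seteqP; split => // w [[_ /= h1] [_ /=]]; rewrite ltNge h1.
    have -> : y @^-1` Good = F `|` F'.
      apply/seteqP; split => w /=; last by case=> -[].
      by move=> Gw; case: (leP (normF (pinv (y w) *m xi w) ^+ 2) (s ^- 2 * K)) => h;
        [left|right].
    exact: measureU.
  have mF : measurable F by exact: measurableI.
  have QF : Q F \is a fin_num by exact: fin_num_measure.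
  move: QGood; rewrite splitG => QGood.
  (* The budget: 1 - 2 delta / 3 <= Q F + delta / 3. *)
  have := le_trans QGood (leeD2l (Q F) tail).
  rewrite expt -(fineK QF) -EFinD !lee_fin; lra.
Qed.
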